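(* Any self-dual $4$-form $\omega$ on $\mathbb R^8$ satisfying $$\frac{|\omega|^2}{\|\omega\|^2}=14$$ is $\mathrm{SO}(8)$-conjugate to the Cayley form $\omega_{\rm Ca}$.
   Context: $\mathbb R^8$ carries its standard Euclidean inner product and orientation; $e_1,\dots,e_8$ is the basis of the dual space which is dual to the standard orthonormal basis. The Euclidean norm $|\cdot|$ on $\Lambda^4(\mathbb R^8)$ is the one for which the forms $e_j\wedge e_k\wedge e_l\wedge e_m$ ($j<k<l<m$) are orthonormal. The comass of a $k$-form $\omega$ is $\|\omega\|=\sup\{\omega(v_1,\dots,v_k): |v_i|=1 \text{ for all } i\}$. A $4$-form is self-dual if it is fixed by the Hodge star $*$. $\mathrm{SO}(8)$ acts on $4$-forms by the natural action. For distinct indices write $e^{jklm}:=e_j\wedge e_k\wedge e_l\wedge e_m+{*}(e_j\wedge e_k\wedge e_l\wedge e_m)$. The Cayley form is $$\omega_{\rm Ca}=e^{1234}+e^{1256}+e^{1278}+e^{1357}-e^{1368}-e^{1458}-e^{1467}.$$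
   Formalization: The form is shown SO(8)-conjugate to a nonzero real multiple (either sign) of the Cayley form, not to the Cayley form itself: 2ω_Ca and −ω_Ca are self-dual with ratio 14 but are not SO(8)-conjugate to ω_Ca. *)

(* Defs.v *)
From HB Require Import structures.
From mathcomp Require Import all_boot all_order all_algebra.
From mathcomp Require Import boolp classical_sets reals.

Set Implicit Arguments.
Unset Strict Implicit.
Unset Printing Implicit Defensive.

Import Order.TTheory GRing.Theory Num.Theory.
Local Open Scope classical_set_scope.
Local Open Scope ring_scope.

(* A k-form on R^n is a function of k vectors of R^n, given as the rows of a
   k x n matrix.  The two conditions have the same shape as
   [determinant_multilinear] and [determinant_alternate]. *)
Definition is_form (R : realType) (k n : nat) (w : 'M[R]_(k, n) -> R) : Prop :=
  (forall (A B C : 'M[R]_(k, n)) (i : 'I_k) (b c : R),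
     row i A = b *: row i B + c *: row i C ->
     row' i B = row' i A -> row' i C = row' i A ->
     w A = b * w B + c * w C) /\
  (forall (A : 'M[R]_(k, n)) (i j : 'I_k),
     i != j -> row i A = row j A -> w A = 0).

Definition increasing (k n : nat) (J : k.-tuple 'I_n) : bool :=
  sorted ltn [seq val i | i <- J].

Definition basis_rows (R : realType) (k n : nat) (J : k.-tuple 'I_n) :
    'M[R]_(k, n) :=
  rowsub (tnth J) 1%:M.

(* e_{J_1} /\ ... /\ e_{J_k}, normalized so as to take the value 1 at the basis
   vectors with indices J_1, ..., J_k. *)
Definition wedge_basis (R : realType) (k n : nat) (J : k.-tuple 'I_n) :
    'M[R]_(k, n) -> R :=
  fun v => \det (colsub (tnth J) v).

(* The coefficient of a form w on the basis form [wedge_basis J] is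
   [w (basis_rows J)]. *)
Definition form_norm (R : realType) (k n : nat) (w : 'M[R]_(k, n) -> R) : R :=
  Num.sqrt (\sum_(J : k.-tuple 'I_n | increasing J) w (basis_rows R J) ^+ 2).

(* The norm that the analysis library puts on row vectors is the sup norm,
   hence this definition. *)
Definition euclidean_norm (R : realType) (n : nat) (x : 'rV[R]_n) : R :=
  Num.sqrt (\sum_(j < n) x 0 j ^+ 2).

Definition comass (R : realType) (k n : nat) (w : 'M[R]_(k, n) -> R) : R :=
  sup [set w v | v in [set v : 'M[R]_(k, n) |
                       forall i, euclidean_norm (row i v) = 1]].

(* The linear extension of e_J |-> *e_J, where
   ( *e_J)(v_1, ..., v_l) = vol(e_{J_1}, ..., e_{J_k}, v_1, ..., v_l) and
   vol = \det is the standard volume form of R^(k + l); equivalently *e_J is,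
   up to sign, the basis form of the complementary indices, the sign being such
   that e_J /\ *e_J = vol. *)
Definition hodge (R : realType) (k l : nat) (w : 'M[R]_(k, k + l) -> R) :
    'M[R]_(l, k + l) -> R :=
  fun v => \sum_(J : k.-tuple 'I_(k + l) | increasing J)
             w (basis_rows R J) * \det (col_mx (basis_rows R J) v).

Definition self_dual (R : realType) (w : 'M[R]_(4, 8) -> R) : Prop :=
  forall v, @hodge R 4 4 w v = w v.

Definition special_orthogonal (R : realType) (n : nat) (g : 'M[R]_n) : Prop :=
  g *m g^T = 1%:M /\ \det g = 1.

(* (g . w)(v_1, ..., v_k) = w(g^-1 v_1, ..., g^-1 v_k); the vectors are rows,
   so that g^-1 acts on them as right multiplication by its transpose. *)
Definition form_act (R : realType) (k n : nat) (g : 'M[R]_n)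
    (w : 'M[R]_(k, n) -> R) : 'M[R]_(k, n) -> R :=
  fun v => w (v *m (invmx g)^T).

(* e^{jklm} for j, k, l, m in 1 .. 8; ordinals are numbered from 0. *)
Definition e4 (R : realType) (j k l m : nat) : 'M[R]_(4, 8) -> R :=
  let w := wedge_basis (R := R)
    [tuple inord j.-1 : 'I_8; inord k.-1; inord l.-1; inord m.-1] in
  fun v => w v + @hodge R 4 4 w v.

Definition cayley (R : realType) : 'M[R]_(4, 8) -> R :=
  fun v => e4 1 2 3 4 v + e4 1 2 5 6 v + e4 1 2 7 8 v + e4 1 3 5 7 v
         - e4 1 3 6 8 v - e4 1 4 5 8 v - e4 1 4 6 7 v.

(* Main.v *)
Require Import Defs.
From HB Require Import structures.
From mathcomp Require Import all_boot all_order all_algebra.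
From mathcomp Require Import boolp classical_sets reals.
From mathcomp Require Import fingroup perm ring lra zify.
From mathcomp Require Import topology normedtype derive.

(* Rotate the frame by SO(8) so that the coefficients of w on e1234, e1256 and
   e1357 are lexicographically maximal.  The first-order conditions along
   coordinate rotations, together with self-duality, kill every coefficient
   except those on the seven 4-sets occurring in the Cayley form and on their
   complements.  These 14 coefficients are bounded by the comass M and have
   sum of squares 14 M^2, so all of them are M or -M, and the three maximized
   ones are M.  The value of w at planes spanned by (e_a +- e_b) / sqrt 2, for
   suitable pairings {a, b} of the 8 indices, is half a signed sum of four of
   the seven coefficients; bounding it by M leaves two sign patterns: M times
   the Cayley form, and -M times the Cayley form after a change of the signs of
   e1, e2, e3 and e5. *)

Set Implicit Arguments.
Unset Strict Implicit.
Unset Printing Implicit Defensive.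

Import Order.TTheory GRing.Theory Num.Theory.
Import numFieldNormedType.Exports.
Local Open Scope ring_scope.

(** With indices numbered from 0 and read as points of F_2^3 in binary, the fourteen surviving
    4-sets are the affine planes, that is, the weight-four words of the extended Hamming code; the
    three maximized sets are the coordinate planes through 0. They cut the indices into halves,
    pairs and single points, and since the code is self-dual, a 4-set that is not an affine plane
    meets one of them in an odd number of indices. The maximum is lexicographic because a
    coefficient can only be compared along rotations that preserve the earlier ones. A rotation
    mixing two indices that no earlier set separates fixes the earlier coefficients exactly and
    turns the current one, a, into c a + s b with (c, s) on the unit circle; b = 0 then follows from
    evaluation at one point, without derivatives. All remaining combinatorics is finite:
    coefficients are indexed by lists of natural numbers, so that facts about the seventy 4-sets and
    their signs are decided by computation. *)

(** * Multilinear functions of the rows and their expansion on basis vectors *)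

Definition row_linear (R : realType) (k n : nat) (w : 'M[R]_(k, n) -> R) : Prop :=
  forall (A B C : 'M[R]_(k, n)) (i : 'I_k) (b c : R),
     row i A = b *: row i B + c *: row i C ->
     row' i B = row' i A -> row' i C = row' i A ->
     w A = b * w B + c * w C.

Lemma form_linear (R : realType) (k n : nat) (w : 'M[R]_(k, n) -> R) :
  is_form w -> row_linear w.
Proof. by case. Qed.

Definition upd (R : realType) (k n : nat) (i : 'I_k) (u : 'rV[R]_n)
    (A : 'M[R]_(k, n)) : 'M[R]_(k, n) :=
  \matrix_(a, b) if a == i then u 0 b else A a b.

Lemma eq_row' (T : Type) (k n : nat) (i : 'I_k) (A B : 'M[T]_(k, n)) :
  (forall a j, a != i -> A a j = B a j) -> row' i A = row' i B.
Proof. by move=> AB; apply/matrixP=> a j; rewrite !mxE AB // eq_sym neq_lift. Qed.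

Lemma row_upd (R : realType) (k n : nat) (i : 'I_k) (u : 'rV[R]_n) A :
  row i (upd i u A) = u.
Proof. by apply/rowP=> j; rewrite !mxE eqxx. Qed.

Lemma row'_upd (R : realType) (k n : nat) (i : 'I_k) (u : 'rV[R]_n) A :
  row' i (upd i u A) = row' i A.
Proof. by apply: eq_row' => a j /negbTE ai; rewrite mxE ai. Qed.

Lemma upd_row (R : realType) (k n : nat) (i : 'I_k) (A : 'M[R]_(k, n)) :
  upd i (row i A) A = A.
Proof. by apply/matrixP=> a j; rewrite !mxE; case: eqP => // ->. Qed.

Lemma updC (R : realType) (k n : nat) (i j : 'I_k) (u v : 'rV[R]_n) A :
  i != j -> upd i u (upd j v A) = upd j v (upd i u A).
Proof.
by move=> ij; apply/matrixP=> a b; rewrite !mxE; case: eqP => // ->; rewrite (negbTE ij).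
Qed.

Lemma linear_upd (R : realType) (k n : nat) (w : 'M[R]_(k, n) -> R) i b c u v A :
  row_linear w ->
  w (upd i (b *: u + c *: v) A) = b * w (upd i u A) + c * w (upd i v A).
Proof. by move=> lw; apply: (lw _ _ _ i); rewrite ?row_upd ?row'_upd. Qed.

Lemma linear_updZ (R : realType) (k n : nat) (w : 'M[R]_(k, n) -> R) i b u A :
  row_linear w -> w (upd i (b *: u) A) = b * w (upd i u A).
Proof.
move=> lw; have := linear_upd i b 0 u 0 A lw.
by rewrite scaler0 addr0 mul0r addr0.
Qed.

Lemma linear_upd_sum (R : realType) (k n : nat) (w : 'M[R]_(k, n) -> R)
    (T : Type) (r : seq T) i (c : T -> R) (u : T -> 'rV[R]_n) A :
  row_linear w ->
  w (upd i (\sum_(t <- r) c t *: u t) A) = \sum_(t <- r) c t * w (upd i (u t) A).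
Proof.
move=> lw; elim: r => [|t r IH].
  by rewrite !big_nil -(scale0r 0) linear_updZ // mul0r.
by rewrite !big_cons -[X in _ + X]scale1r linear_upd // IH mul1r.
Qed.

(** Induction on a bound m such that all rows from m on are already basis vectors; each step expands
    one more row. *)
Lemma row_linear_ext (R : realType) (k n : nat) (w x : 'M[R]_(k, n) -> R) :
  row_linear w -> row_linear x ->
  (forall f : 'I_k -> 'I_n, w (rowsub f 1%:M) = x (rowsub f 1%:M)) -> w =1 x.
Proof.
move=> lw lx wx.
suff H m : forall A : 'M[R]_(k, n),
    (forall i : 'I_k, (m <= i)%N -> exists j, row i A = delta_mx 0 j) -> w A = x A.
  by move=> A; apply: (H k) => i; rewrite leqNgt ltn_ord.
elim: m => [A HA | m IH A HA].
  have [f Hf] := fin_all_exists (fun i => HA i (leq0n i)).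
  suff -> : A = rowsub f 1%:M by [].
  apply/matrixP=> i j; have /rowP/(_ j) := Hf i.
  by rewrite !mxE eqxx /= eq_sym.
case: (ltnP m k) => [mk | km]; last first.
  by apply: IH => i mi; have := leq_trans (leq_trans (ltn_ord i) km) mi; rewrite ltnn.
pose i := Ordinal mk.
rewrite -(upd_row i A) (row_sum_delta (row i A)) !linear_upd_sum //.
apply: eq_bigr => j _; congr (_ * _).
apply: IH => a; rewrite leq_eqVlt => /orP[/eqP ma | ma].
  by have -> : a = i; [apply: val_inj | exists j; rewrite row_upd].
have [l Hl] := HA a ma; exists l; rewrite -Hl.
by apply/rowP=> b; rewrite !mxE ifN // -val_eqE /= gtn_eqF.
Qed.

Lemma row_linear_expand (R : realType) (k n : nat) (w : 'M[R]_(k, n) -> R) A :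
  row_linear w ->
  w A = \sum_(f : {ffun 'I_k -> 'I_n}) (\prod_i A i (f i)) * w (rowsub f 1%:M).
Proof.
move=> lw.
pose x A := \sum_(f : {ffun 'I_k -> 'I_n}) (\prod_i A i (f i)) * w (rowsub f 1%:M).
apply: (row_linear_ext (x := x)) => // [B C D i b c Bi CB DB | g]; rewrite /x.
  rewrite !mulr_sumr -big_split /=; apply: eq_bigr => f _.
  have E (M : 'M[R]_(k, n)) : \prod_j M j (f j) = M i (f i) * \prod_(j | j != i) M j (f j).
    by rewrite (bigD1 i).
  have -> : \prod_j B j (f j) = B i (f i) * \prod_(j | j != i) C j (f j).
    by rewrite E; congr (_ * _); apply: eq_bigr => j ji; rewrite (row'_eq CB).
  have -> : \prod_j D j (f j) = D i (f i) * \prod_(j | j != i) C j (f j).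
    by rewrite E; congr (_ * _); apply: eq_bigr => j ji; rewrite (row'_eq DB) // (row'_eq CB).
  rewrite E.
  by move/rowP/(_ (f i)): Bi; rewrite !mxE => ->; ring.
rewrite (bigD1 (finfun g)) //= big1 ?mul1r => [|i _]; last by rewrite !mxE ffunE eqxx.
rewrite big1 ?addr0 => [|f fg].
  by congr w; apply/matrixP=> i j; rewrite !mxE ffunE.
have [i gi] : exists i, f i != g i.
  apply/existsP; rewrite -negb_forall; apply: contra fg => /forallP fg.
  by apply/eqP/ffunP=> i; rewrite ffunE; apply/eqP.
by rewrite (bigD1 i) //= !mxE eq_sym (negbTE gi) !mul0r.
Qed.

(** The sum runs over all index functions, not only increasing ones, because it then factors row by
    row into entries of g^T g. *)
Lemma row_linear_orthogonal (R : realType) (k n : nat) (w x : 'M[R]_(k, n) -> R)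
    (g : 'M[R]_n) :
  row_linear w -> row_linear x -> g *m g^T = 1%:M ->
  \sum_(f : {ffun 'I_k -> 'I_n}) w (rowsub f g) * x (rowsub f g) =
  \sum_(f : {ffun 'I_k -> 'I_n}) w (rowsub f 1%:M) * x (rowsub f 1%:M).
Proof.
move=> lw lx /mulmx1C gg.
under eq_bigr => f _.
  rewrite (row_linear_expand _ lw) (row_linear_expand _ lx) mulr_suml.
  under eq_bigr => a _ do rewrite mulr_sumr.
  over.
rewrite exchange_big; apply: eq_bigr => a _; rewrite exchange_big /=.
(* The tensor products of the columns of g are again orthonormal. *)
have K (b : {ffun 'I_k -> 'I_n}) :
    \sum_(f : {ffun 'I_k -> 'I_n})
      (\prod_i g (f i) (a i)) * (\prod_i g (f i) (b i)) = (a == b)%:R.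
  under eq_bigr => f _ do rewrite -big_split /=.
  rewrite -(bigA_distr_bigA (fun i j => g j (a i) * g j (b i))).
  have H i : \sum_j g j (a i) * g j (b i) = (a i == b i)%:R.
    move/matrixP/(_ (a i) (b i)): gg; rewrite !mxE => <-.
    by apply: eq_bigr => j _; rewrite mxE.
  under eq_bigr => i _ do rewrite H.
  case: eqP => [-> | ab]; first by rewrite big1 // => i _; rewrite eqxx.
  have [i abi] : exists i, a i != b i.
    apply/existsP; rewrite -negb_forall; apply/negP=> /forallP E.
    by apply: ab; apply/ffunP=> i; apply/eqP.
  by rewrite (bigD1 i) //= (negbTE abi) mul0r.
transitivity (\sum_b (a == b)%:R * (w (rowsub a 1%:M) * x (rowsub b 1%:M))).
  apply: eq_bigr => b _; rewrite -K mulr_suml; apply: eq_bigr => f _.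
  under eq_bigr => i _ do rewrite !mxE.
  under [X in _ * (X * _)]eq_bigr => i _ do rewrite !mxE.
  by ring.
by rewrite (bigD1 a) //= eqxx mul1r big1 ?addr0 // => b /negbTE; rewrite eq_sym => ->; rewrite mul0r.
Qed.

(** * Alternation, and sums over increasing index tuples *)

Lemma form_alternate (R : realType) (k n : nat) (w : 'M[R]_(k, n) -> R)
    (i j : 'I_k) A :
  is_form w -> i != j -> row i A = row j A -> w A = 0.
Proof. by case=> _ /(_ A i j). Qed.

Lemma form_tperm (R : realType) (k n : nat) (w : 'M[R]_(k, n) -> R) (i j : 'I_k) A :
  is_form w -> i != j -> w (row_perm (tperm i j) A) = - w A.
Proof.
move=> fw ij; have lw := form_linear fw.
pose D u v := w (upd i u (upd j v A)).
have D0 u : D u u = 0.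
  by apply: (form_alternate fw ij); rewrite updC // row_upd updC 1?eq_sym // row_upd.
have Dl u u' v : D (u + u') v = D u v + D u' v.
  by rewrite /D -[u]scale1r -[u' in LHS]scale1r linear_upd // !mul1r scale1r.
have Dr u v v' : D u (v + v') = D u v + D u v'.
  rewrite /D updC // -[v]scale1r -[v' in LHS]scale1r linear_upd // !mul1r scale1r.
  by rewrite ![upd j _ (upd i _ _)]updC // eq_sym.
have -> : w A = D (row i A) (row j A) by rewrite /D !upd_row.
have -> : row_perm (tperm i j) A = upd i (row j A) (upd j (row i A) A).
  by apply/matrixP=> a b; rewrite !mxE; case: tpermP => [->|->|/eqP/negbTE-> /eqP/negbTE->]//;
     rewrite eqxx // eq_sym (negbTE ij).
have := D0 (row i A + row j A); rewrite Dl !Dr !D0 add0r addr0 => /eqP.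
by rewrite addrC addr_eq0 => /eqP.
Qed.

Lemma form_row_perm (R : realType) (k n : nat) (w : 'M[R]_(k, n) -> R) (s : 'S_k) A :
  is_form w -> w (row_perm s A) = (-1) ^+ s * w A.
Proof.
move=> fw; have [ts -> dts] := prod_tpermP s.
elim: ts dts A => [_ A | t ts IH /=/andP[dt dts] A].
  by rewrite big_nil row_perm1 odd_perm1 mul1r.
rewrite big_cons row_permM odd_permM odd_tperm dt form_tperm // IH //.
by rewrite signr_addb mulNr mul1r mulNr.
Qed.

Lemma form_rowsub_noninj (R : realType) (k n m : nat) (w : 'M[R]_(k, n) -> R)
    (f : 'I_k -> 'I_m) A :
  is_form w -> ~~ injectiveb f -> w (rowsub f A) = 0.
Proof.
move=> fw /injectivePn[i [j ij fij]]; apply: (form_alternate fw ij).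
by apply/rowP=> b; rewrite !mxE fij.
Qed.

(** Existence comes from sorting the values of f; uniqueness holds because a strictly increasing
    list is determined by its members and f is injective. *)
Lemma sorting_perm_uniq (k n : nat) (f : 'I_k -> 'I_n) : injective f ->
  #|[pred s : 'S_k | increasing [tuple f (s i) | i < k]]| = 1%N.
Proof.
move=> fI.
have val_mktuple (s : 'S_k) : [seq val i | i <- [tuple f (s i) | i < k]] =
    [seq val i | i <- map f (map s (enum 'I_k))].
  by rewrite /= -!map_comp; apply: eq_map.
have perm_im (s : 'S_k) : perm_eq (map s (enum 'I_k)) (enum 'I_k).
  apply: uniq_perm; rewrite ?enum_uniq //.
    by rewrite map_inj_uniq ?enum_uniq //; apply: perm_inj.
  by move=> i; rewrite mem_enum -{1}(permKV s i) map_f // mem_enum.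
pose le (x y : 'I_n) := (x <= y)%N.
pose t := [tuple f i | i < k].
have /tuple_permP[s Hs] : perm_eq (sort_tuple le t) t by rewrite perm_sort.
have incP (p : 'S_k) : increasing [tuple f (p i) | i < k] =
   sorted ltn (map val [tuple f (p i) | i < k]) by [].
apply/eqP/card1P; exists s => p; rewrite !inE.
have srt : increasing [tuple f (s i) | i < k].
  rewrite /increasing ltn_sorted_uniq_leq; apply/andP; split.
    rewrite val_mktuple (map_inj_uniq val_inj) (map_inj_uniq fI).
    by rewrite (map_inj_uniq (@perm_inj _ s)) enum_uniq.
  have -> : [tuple f (s i) | i < k] = [tuple tnth t (s i) | i < k].
    by apply: eq_from_tnth => i; rewrite !tnth_mktuple.
  rewrite -Hs sorted_map; apply: sort_sorted => x y; exact: leq_total.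
apply/idP/eqP => [ip | -> //].
have E : [seq val i | i <- [tuple f (p i) | i < k]] = [seq val i | i <- [tuple f (s i) | i < k]].
  apply: (irr_sorted_eq ltn_trans ltnn ip srt).
  by apply: perm_mem; rewrite !val_mktuple !perm_map // (perm_trans (perm_im p)) // perm_sym.
apply/permP=> i; apply: fI.
by move/(inj_map val_inj)/val_inj: E => /(congr1 (fun t => tnth t i)); rewrite !tnth_mktuple.
Qed.

(* Both sides are evaluated as a sum over the pairs of an index function and a
   permutation sorting it. *)
Lemma sum_increasing (R : realType) (k n : nat) (F : {ffun 'I_k -> 'I_n} -> R) :
  (forall f : {ffun 'I_k -> 'I_n}, ~~ injectiveb f -> F f = 0) ->
  (forall (f : {ffun 'I_k -> 'I_n}) (s : 'S_k), F [ffun i => f (s i)] = F f) ->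
  \sum_f F f = k`!%:R * \sum_(J : k.-tuple 'I_n | increasing J) F [ffun i => tnth J i].
Proof.
move=> F0 Fs.
transitivity (\sum_(f : {ffun 'I_k -> 'I_n}) \sum_(s : 'S_k | increasing [tuple f (s i) | i < k]) F f).
  apply: eq_bigr => f _; rewrite sumr_const.
  case: (boolP (injectiveb f)) => [/injectiveP fI | /F0 ->]; last by rewrite mul0rn.
  by rewrite sorting_perm_uniq.
rewrite (exchange_big_dep predT) //=.
transitivity (\sum_(s : 'S_k) \sum_(J : k.-tuple 'I_n | increasing J) F [ffun i => tnth J i]).
  apply: eq_bigr => s _.
  rewrite (reindex (fun J : k.-tuple 'I_n => [ffun i => tnth J ((s^-1)%g i)])) /=; last first.
    exists (fun f : {ffun 'I_k -> 'I_n} => [tuple f (s i) | i < k]) => [J _ | f _].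
      by apply: eq_from_tnth => i; rewrite tnth_mktuple ffunE permK.
    by apply/ffunP=> i; rewrite ffunE tnth_mktuple permKV.
  apply: eq_big => [J | J _].
    congr increasing; apply: eq_from_tnth => i; rewrite tnth_mktuple ffunE permK //.
  rewrite -[RHS](Fs _ (s^-1)%g); congr F; apply/ffunP=> i; by rewrite !ffunE.
rewrite sumr_const mulr_natl; congr (_ *+ _).
by rewrite -card_Sn; apply: eq_card => s; rewrite inE.
Qed.

Lemma sum_increasing_forms (R : realType) (k n : nat) (w x : 'M[R]_(k, n) -> R) (A : 'M[R]_n) :
  is_form w -> is_form x ->
  \sum_(f : {ffun 'I_k -> 'I_n}) w (rowsub f A) * x (rowsub f A) =
  k`!%:R * \sum_(J : k.-tuple 'I_n | increasing J)
             w (rowsub (tnth J) A) * x (rowsub (tnth J) A).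
Proof.
move=> fw fx; rewrite sum_increasing.
- congr (_ * _); apply: eq_bigr => J _.
  by have -> : rowsub [ffun i => tnth J i] A = rowsub (tnth J) A
    by apply/matrixP=> i j; rewrite !mxE ffunE.
- by move=> f nf; rewrite form_rowsub_noninj // mul0r.
move=> f s; have -> : rowsub [ffun i => f (s i)] A = row_perm s (rowsub f A).
  by apply/matrixP=> i j; rewrite !mxE ffunE.
by rewrite !form_row_perm // mulrACA -signr_addb addbb mul1r.
Qed.

(** Invariance of the inner product on k-forms, obtained from the sum over all index functions by
    cancelling k!. Taking x = w gives the invariance of the norm; taking for x a determinant with
    some rows fixed gives that of the Hodge star. *)
Lemma form_inner_orthogonal (R : realType) (k n : nat) (w x : 'M[R]_(k, n) -> R)
    (g : 'M[R]_n) :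
  is_form w -> is_form x -> g *m g^T = 1%:M ->
  \sum_(J : k.-tuple 'I_n | increasing J)
     w (rowsub (tnth J) g) * x (rowsub (tnth J) g) =
  \sum_(J : k.-tuple 'I_n | increasing J)
     w (basis_rows R J) * x (basis_rows R J).
Proof.
move=> fw fx gg.
have k0 : k`!%:R != 0 :> R by rewrite pnatr_eq0 -lt0n fact_gt0.
apply: (mulfI k0); rewrite -!sum_increasing_forms //.
by apply: row_linear_orthogonal => //; apply: form_linear.
Qed.

(** * Determinants as forms, and the action of SO(n) on forms and on the Hodge star *)

(** A common pattern for the determinants below: the rows at the positions [phi i] depend linearly
    on the arguments, through H, and the other rows are constant, taken from N. *)
Lemma is_form_det (R : realType) (k m n : nat) (phi : 'I_k -> 'I_m)
    (M : 'M[R]_(k, n) -> 'M[R]_m) (H : 'M[R]_(n, m)) (N : 'M[R]_m) :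
  injective phi ->
  (forall v i, row (phi i) (M v) = row i v *m H) ->
  (forall v a, (forall i, phi i != a) -> row a (M v) = row a N) ->
  is_form (fun v => \det (M v)).
Proof.
move=> phiI Mphi MN; split=> [A B C i b c Ai BA CA | A i j ij Aij]; last first.
  apply: (@determinant_alternate _ _ _ (phi i) (phi j)); first by rewrite (inj_eq phiI).
  by move=> b; have /rowP/(_ b) : row (phi i) (M A) = row (phi j) (M A);
     [rewrite !Mphi Aij | rewrite !mxE].
have K (D : 'M[R]_(k, n)) : row' i D = row' i A -> row' (phi i) (M D) = row' (phi i) (M A).
  move=> DA; apply: eq_row' => a j ai.
  suff /rowP/(_ j) : row a (M D) = row a (M A) by rewrite !mxE.
  have [/existsP[t /eqP ta] | /existsPn na] := boolP [exists t, phi t == a].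
    rewrite -ta !Mphi; congr (_ *m _); apply/rowP=> l; rewrite !mxE.
    by apply: (row'_eq DA); rewrite inE; apply: contra ai => /eqP <-; rewrite ta.
  by rewrite !MN.
apply: (@determinant_multilinear _ _ _ _ _ (phi i)); rewrite ?K //.
by rewrite !Mphi Ai mulmxDl !scalemxAl.
Qed.

Lemma is_form_det_id (R : realType) (n : nat) : is_form (fun A : 'M[R]_n => \det A).
Proof.
apply: (is_form_det (phi := id) (H := 1%:M) (N := 0)) => // [v i | v a /(_ a)].
  by rewrite mulmx1.
by rewrite eqxx.
Qed.

Lemma is_form_det_col_mx (R : realType) (k l : nat) (v : 'M[R]_(l, k + l)) :
  is_form (fun u : 'M[R]_(k, k + l) => \det (col_mx u v)).
Proof.
apply: (is_form_det (phi := lshift l) (H := 1%:M) (N := col_mx 0 v)).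
- exact: lshift_inj.
- by move=> u i; rewrite mulmx1 rowKu.
by move=> u a na; case: (split_ordP a) na => [j -> /(_ j)/eqP// | j -> _]; rewrite !rowKd.
Qed.

Lemma is_form_det_col_mxr (R : realType) (k l : nat) (u : 'M[R]_(k, k + l)) :
  is_form (fun v : 'M[R]_(l, k + l) => \det (col_mx u v)).
Proof.
apply: (is_form_det (phi := @rshift k l) (H := 1%:M) (N := col_mx u 0)).
- exact: rshift_inj.
- by move=> v i; rewrite mulmx1 rowKd.
by move=> v a na; case: (split_ordP a) na => [j -> _ | j -> /(_ j)/eqP//]; rewrite !rowKu.
Qed.

Lemma is_form_det_colsub (R : realType) (k n : nat) (f : 'I_k -> 'I_n) :
  is_form (fun v : 'M[R]_(k, n) => \det (colsub f v)).
Proof.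
apply: (is_form_det (phi := id) (H := colsub f 1%:M) (N := 0)) => // [v i | v a /(_ a)].
  by rewrite mulmx_colsub mulmx1; apply/rowP=> j; rewrite !mxE.
by rewrite eqxx.
Qed.

Lemma is_form_mulmxr (R : realType) (k n : nat) (w : 'M[R]_(k, n) -> R) (g : 'M[R]_n) :
  is_form w -> is_form (fun v => w (v *m g)).
Proof.
move=> fw; split=> [A B C i b c Ai BA CA | A i j ij Aij].
  have E (X : 'M[R]_(k, n)) : row' i (X *m g) = row' i X *m g.
    by rewrite !row'Esub mul_rowsub_mx.
  apply: (form_linear fw (i := i)).
  - by rewrite !row_mul Ai mulmxDl !scalemxAl.
  - by rewrite !E BA.
  - by rewrite !E CA.
by apply: (form_alternate fw ij); rewrite !row_mul Aij.
Qed.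

(** The Hodge star at v is the inner product of w with the form sending u to the determinant of u
    stacked on v. That inner product is invariant under g, and the factor \det g = 1 moves g from u
    to v. *)
Lemma hodge_mulmxr (R : realType) (k l : nat) (w : 'M[R]_(k, k + l) -> R)
    (g : 'M[R]_(k + l)) v :
  is_form w -> special_orthogonal g ->
  hodge (fun u => w (u *m g)) v = hodge w (v *m g).
Proof.
move=> fw [gg dg]; rewrite /hodge.
rewrite -(form_inner_orthogonal fw (is_form_det_col_mx _) gg).
apply: eq_bigr => J _.
have E : basis_rows R J *m g = rowsub (tnth J) g.
  by rewrite /basis_rows mul_rowsub_mx mul1mx.
by rewrite E -[in LHS](mulr1 (\det _)) -dg -det_mulmx mul_col_mx E.
Qed.

Lemma self_dual_mulmxr (R : realType) (w : 'M[R]_(4, 8) -> R) (g : 'M[R]_8) :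
  is_form w -> self_dual w -> special_orthogonal g ->
  self_dual (fun v => w (v *m g)).
Proof. by move=> fw sw og v; rewrite (@hodge_mulmxr R 4 4) // sw. Qed.

(** * Rotations in coordinate planes *)

(** The rows are the images of the basis vectors, so [rowsub f] of this matrix is a rotated tuple of
    basis vectors. The values c = -1, s = 0 give the half-turn that changes the signs of two basis
    vectors. *)
Definition plane_rotation (R : realType) (n : nat) (p q : 'I_n) (c s : R) : 'M[R]_n :=
  upd p (c *: delta_mx 0 p + s *: delta_mx 0 q)
    (upd q (- s *: delta_mx 0 p + c *: delta_mx 0 q) 1%:M).

(** Both rotated vectors occur among the arguments, and their wedge is multiplied by the determinant
    c^2 + s^2 = 1 of the rotation. *)
Lemma form_plane_rotation_both (R : realType) (k n : nat) (w : 'M[R]_(k, n) -> R)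
    (f : 'I_k -> 'I_n) (i j : 'I_k) (c s : R) :
  is_form w -> injective f -> i != j -> c ^+ 2 + s ^+ 2 = 1 ->
  w (rowsub f (plane_rotation (f i) (f j) c s)) = w (rowsub f 1%:M).
Proof.
move=> fw fI ij cs; have lw := form_linear fw.
pose D u v := w (upd i u (upd j v (rowsub f 1%:M))).
have -> : w (rowsub f (plane_rotation (f i) (f j) c s)) =
  D (c *: delta_mx 0 (f i) + s *: delta_mx 0 (f j)) (- s *: delta_mx 0 (f i) + c *: delta_mx 0 (f j)).
  by congr w; apply/matrixP=> a b; rewrite !mxE !(inj_eq fI).
have D0 u : D u u = 0.
  by apply: (form_alternate fw ij); rewrite updC // row_upd updC 1?eq_sym // row_upd.
have Dr u b v d v' : D u (b *: v + d *: v') = b * D u v + d * D u v'.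
  by rewrite /D updC // linear_upd // ![upd j _ (upd i _ _)]updC // eq_sym.
have Dl u b v d v' : D (b *: v + d *: v') u = b * D v u + d * D v' u.
  by rewrite /D linear_upd.
have rf a : row a (rowsub f 1%:M) = delta_mx 0 (f a) :> 'rV[R]_n.
  by apply/rowP=> b; rewrite !mxE eqxx eq_sym.
have E1 : D (delta_mx 0 (f i)) (delta_mx 0 (f j)) = w (rowsub f 1%:M).
  by rewrite /D -!rf !upd_row.
have E2 : D (delta_mx 0 (f j)) (delta_mx 0 (f i)) = - w (rowsub f 1%:M).
  have := D0 (1 *: delta_mx 0 (f i) + 1 *: delta_mx 0 (f j)); rewrite Dl !Dr !D0 E1 !mul1r add0r addr0.
  by move/eqP; rewrite addrC addr_eq0 => /eqP.
by rewrite Dl !Dr !D0 E1 E2 -[RHS]mul1r -cs; ring.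
Qed.

Lemma plane_rotation_so (R : realType) (n : nat) (p q : 'I_n) (c s : R) :
  p != q -> c ^+ 2 + s ^+ 2 = 1 -> special_orthogonal (plane_rotation p q c s).
Proof.
move=> pq cs; split; last first.
  (* The determinant is itself a form, so its value on the rotated basis is its value on the
     basis. *)
  have := form_plane_rotation_both (is_form_det_id R n) (@inj_id _) pq cs.
  by rewrite !mxsub_id det1.
have dd (a b : 'I_n) : (delta_mx 0 a : 'rV[R]_n) *m (delta_mx 0 b)^T = (a == b)%:R%:M.
  rewrite trmx_delta; apply/matrixP=> i j; rewrite !mxE !ord1 (bigD1 a) //= big1 => [|d da].
    by rewrite !mxE !eqxx /= mul1r addr0 andbT mulr1n.
  by rewrite !mxE (negbTE da) andbF mul0r.
pose r (a : 'I_n) : 'rV[R]_n := if a == p then c *: delta_mx 0 p + s *: delta_mx 0 q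
   else if a == q then - s *: delta_mx 0 p + c *: delta_mx 0 q else delta_mx 0 a.
have rE a : row a (plane_rotation p q c s) = r a.
  by apply/rowP=> b; rewrite !mxE /r; case: ifP => _; [|case: ifP => _]; rewrite !mxE // eqxx eq_sym.
apply/matrixP=> a b.
have -> : (plane_rotation p q c s *m (plane_rotation p q c s)^T) a b = (r a *m (r b)^T) 0 0.
  by rewrite -!rE !mxE; apply: eq_bigr => j _; rewrite !mxE.
have qp : (q == p) = false by rewrite eq_sym (negbTE pq).
rewrite /r [RHS]mxE; have [?|ap] := eqVneq a p; [subst a|have [?|aq] := eqVneq a q; [subst a|]];
 (have [?|bp] := eqVneq b p; [subst b|have [?|bq] := eqVneq b q; [subst b|]]);
 rewrite ?linearD ?linearZ /= ?mulmxDl ?mulmxDr -?scalemxAl -?scalemxAr ?dd ?mxE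
   ?eqxx ?qp ?(negbTE pq) ?(eq_sym p b) ?(eq_sym q b) ?(negbTE ap) ?(negbTE aq)
   ?(negbTE bp) ?(negbTE bq) ?mulr1n ?mulr0n //; try rewrite -[RHS]cs; ring.
Qed.

Lemma form_plane_rotation_one (R : realType) (k n : nat) (w : 'M[R]_(k, n) -> R)
    (f : 'I_k -> 'I_n) (i : 'I_k) (q : 'I_n) (c s : R) :
  is_form w -> injective f -> (forall j, f j != q) ->
  w (rowsub f (plane_rotation (f i) q c s)) =
  c * w (rowsub f 1%:M) + s * w (rowsub (fun j => if j == i then q else f j) 1%:M).
Proof.
move=> fw fI fq; have lw := form_linear fw.
rewrite -(upd_row i (rowsub f 1%:M)).
have -> : rowsub f (plane_rotation (f i) q c s) =
   upd i (c *: delta_mx 0 (f i) + s *: delta_mx 0 q) (rowsub f 1%:M).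
  by apply/matrixP=> a b; rewrite !mxE (inj_eq fI) (negbTE (fq a)).
rewrite linear_upd //; congr (_ * w _ + _ * w _).
  by apply/matrixP=> a b; rewrite !mxE; case: eqP => // _; rewrite eqxx eq_sym.
by apply/matrixP=> a b; rewrite !mxE; case: eqP => // _; rewrite eqxx eq_sym.
Qed.

Lemma form_plane_rotation_none (R : realType) (k n : nat) (w : 'M[R]_(k, n) -> R)
    (f : 'I_k -> 'I_n) (p q : 'I_n) (c s : R) :
  (forall j, f j != p) -> (forall j, f j != q) ->
  w (rowsub f (plane_rotation p q c s)) = w (rowsub f 1%:M).
Proof.
by move=> fp fq; congr w; apply/matrixP=> a b; rewrite !mxE (negbTE (fp a)) (negbTE (fq a)).
Qed.

(** * Lexicographic maxima over the compact group SO(n) *)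

Local Open Scope classical_set_scope.
Local Open Scope ring_scope.

(** Given a maximum x for the first m functions, the next one is maximized over the set where those
    m functions keep their values at x. This set is closed in A, hence compact, and it contains
    x. *)
Lemma compact_lex_max (R : realType) (T : topologicalType) (A : set T)
    (f : nat -> T -> R) (m : nat) :
  A !=set0 -> compact A -> (forall i, continuous (f i)) ->
  exists2 x, A x & forall i y, (i < m)%N -> A y ->
    (forall j, (j < i)%N -> f j y = f j x) -> f i y <= f i x.
Proof.
move=> A0 cA cf; elim: m => [|m [x Ax maxx]].
  by case: A0 => x Ax; exists x.
pose B := A `&` \bigcap_(j in [set j | (j < m)%N]) (f j @^-1` [set f j x]).
have cB : compact B.
  apply: compact_closedI => //; apply: closed_bigI => j _.
  apply: preimage_closed => [y _|]; first exact: cf.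
  exact: closed_eq.
have [|y yB maxy] := compact_EVT_max _ cB (continuous_subspaceT (cf m)).
  by exists x; split.
have [Ay yx] : B y by exact: set_mem.
exists y => // i z; rewrite ltnS leq_eqVlt => /orP[/eqP -> | im] Az zy.
  by apply: maxy; apply: mem_set; split => // j jm /=; rewrite zy // yx.
rewrite (yx i im); apply: maxx => // j ji; rewrite zy // yx //=.
exact: ltn_trans ji im.
Qed.

Lemma continuous_sum_fun (R : realType) (T : topologicalType) (I : Type) (r : seq I)
    (F : I -> T -> R) :
  (forall i, continuous (F i)) -> continuous (fun x => \sum_(i <- r) F i x).
Proof. by move=> cF; apply: continuous_big => // -[x y]; exact: add_continuous. Qed.

Lemma continuous_prod_fun (R : realType) (T : topologicalType) (I : Type) (r : seq I)
    (F : I -> T -> R) :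
  (forall i, continuous (F i)) -> continuous (fun x => \prod_(i <- r) F i x).
Proof. by move=> cF; apply: continuous_big => // -[x y]; exact: mul_continuous. Qed.

Lemma continuous_mul_fun (R : realType) (T : topologicalType) (F G : T -> R) :
  continuous F -> continuous G -> continuous (fun x => F x * G x).
Proof. by move=> cF cG x; apply: cvgM; [exact: cF | exact: cG]. Qed.

Lemma continuous_vec_mx (R : realType) (m n : nat) (i : 'I_m) (j : 'I_n) :
  continuous (fun v : 'rV[R]_(m * n) => vec_mx v i j).
Proof.
have -> : (fun v : 'rV[R]_(m * n) => vec_mx v i j) = (fun v => v 0 (mxvec_index i j)).
  by apply/funext=> v; rewrite mxE.
exact: coord_continuous.
Qed.

Lemma continuous_row_linear (R : realType) (k m n : nat) (w : 'M[R]_(k, n) -> R)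
    (f : 'I_k -> 'I_m) :
  row_linear w -> continuous (fun v : 'rV[R]_(m * n) => w (rowsub f (vec_mx v))).
Proof.
move=> lw.
have -> : (fun v : 'rV[R]_(m * n) => w (rowsub f (vec_mx v))) =
    fun v => \sum_(g : {ffun 'I_k -> 'I_n})
      (\prod_i vec_mx v (f i) (g i)) * w (rowsub g 1%:M).
  apply/funext=> v; rewrite row_linear_expand //; apply: eq_bigr => g _.
  by congr (_ * _); apply: eq_bigr => i _; rewrite mxE.
apply: continuous_sum_fun => g; apply: continuous_mul_fun; last exact: cst_continuous.
by apply: continuous_prod_fun => i; exact: continuous_vec_mx.
Qed.

(** Matrices are flattened to row vectors, where a product of segments is compact. The entries lie
    in [-1, 1] because the rows are unit vectors, and the defining equations are closed
    conditions. *)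
Lemma compact_special_orthogonal (R : realType) (n : nat) :
  compact [set v : 'rV[R]_(n * n) | special_orthogonal (vec_mx v)].
Proof.
pose C := [set v : 'rV[R]_(n * n) | forall i, `[(-1 : R), 1]%classic (v ord0 i)].
have cC : compact C by apply: (rV_compact (A := fun=> `[(-1 : R), 1]%classic)) => i; exact: segment_compact.
pose D := \bigcap_(ij in [set: 'I_n * 'I_n])
   ((fun v : 'rV[R]_(n * n) => \sum_k vec_mx v ij.1 k * vec_mx v ij.2 k) @^-1` [set (ij.1 == ij.2)%:R]).
(* The [rowsub id] gives the determinant the shape treated by [continuous_row_linear]. *)
pose E := (fun v : 'rV[R]_(n * n) => \det (rowsub id (vec_mx v))) @^-1` [set 1].
have cD : closed D.
  apply: closed_bigI => -[i j] _; apply: preimage_closed; last exact: closed_eq.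
  move=> v _; apply: continuous_sum_fun => k.
  by apply: continuous_mul_fun; exact: continuous_vec_mx.
have cE : closed E.
  apply: preimage_closed; last exact: closed_eq.
  by move=> v _; apply: continuous_row_linear; exact/form_linear/is_form_det_id.
suff -> : [set v : 'rV[R]_(n * n) | special_orthogonal (vec_mx v)] = C `&` (D `&` E).
  by apply: compact_closedI => //; apply: closedI.
have DE (v : 'rV[R]_(n * n)) : D v <-> vec_mx v *m (vec_mx v)^T = 1%:M.
  split=> [Dv | vv [i j] _ /=].
    apply/matrixP=> i j; rewrite !mxE -(Dv (i, j) I) /=; apply: eq_bigr => k _.
    by rewrite [in X in _ * X]mxE.
  move/matrixP/(_ i j): vv; rewrite !mxE => <-; apply: eq_bigr => k _.
  by rewrite [in X in _ = _ * X]mxE.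
apply/seteqP; split=> v /=; last first.
  by move=> [_ [/DE vv]]; rewrite /E /= mxsub_id.
move=> [vv dv]; split; last by split; [apply/DE | rewrite /E /= mxsub_id].
move=> i /=; rewrite -(vec_mxK v); case/mxvec_indexP: i => a b.
rewrite mxvecE in_itv /= -ler_norml -(@expr_le1 _ 2) // -normrX ger0_norm ?sqr_ge0 //.
have := (DE v).2 vv (a, a) I => /=; rewrite eqxx mulr1n (bigD1 b) //= => <-.
rewrite expr2 lerDl; apply: sumr_ge0 => k _; rewrite -expr2; exact: sqr_ge0.
Qed.

Local Close Scope classical_set_scope.

Lemma special_orthogonal1 (R : realType) (n : nat) : special_orthogonal (1%:M : 'M[R]_n).
Proof. by split; rewrite ?det1 // trmx1 mulmx1. Qed.

Lemma special_orthogonalM (R : realType) (n : nat) (g h : 'M[R]_n) :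
  special_orthogonal g -> special_orthogonal h -> special_orthogonal (g *m h).
Proof.
move=> [gg dg] [hh dh]; split; last by rewrite det_mulmx dg dh mulr1.
by rewrite trmx_mul mulmxA -[g *m h *m _]mulmxA hh mulmx1.
Qed.

(** The competitors are written h g, which also runs over SO(n): maximality of g for w thus becomes
    maximality of the standard frame for the form v |-> w(v g). *)
Lemma form_lex_max_frame (R : realType) (k n : nat) (w : 'M[R]_(k, n) -> R)
    (f : nat -> 'I_k -> 'I_n) (m : nat) :
  is_form w ->
  exists2 g, special_orthogonal g & forall i h, (i < m)%N -> special_orthogonal h ->
    (forall j, (j < i)%N -> w (rowsub (f j) h *m g) = w (rowsub (f j) g)) ->
    w (rowsub (f i) h *m g) <= w (rowsub (f i) g).
Proof.
move=> fw.
have [|i|v sv maxv] := @compact_lex_max R _ _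
   (fun i (v : 'rV[R]_(n * n)) => w (rowsub (f i) (vec_mx v))) m _
   (@compact_special_orthogonal R n).
- by exists (mxvec 1%:M); rewrite /= mxvecK; exact: special_orthogonal1.
- exact/continuous_row_linear/form_linear.
exists (vec_mx v) => // i h im sh.
have := maxv i (mxvec (h *m vec_mx v)) im; rewrite /= mxvecK mul_rowsub_mx => H hj.
apply: H; first exact: special_orthogonalM.
by move=> j ji; rewrite -mul_rowsub_mx hj.
Qed.

(** * Coefficients indexed by lists of natural numbers *)

Definition idx (k n : nat) (l : seq nat) : 'I_k -> 'I_n.+1 :=
  fun i => inord (nth 0%N l i).

Arguments idx {k n} l i.

Definition coef (R : realType) (k n : nat) (w : 'M[R]_(k, n.+1) -> R) (l : seq nat) : R :=
  w (rowsub (@idx k n l) 1%:M).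

(* [insert] and [isort] count the adjacent transpositions that they perform. *)
Fixpoint insert (x : nat) (l : seq nat) : nat * seq nat :=
  if l is y :: l' then
    if (x <= y)%N then (0%N, x :: l) else
      let: (m, l'') := insert x l' in (m.+1, y :: l'')
  else (0%N, [:: x]).

Fixpoint isort (l : seq nat) : nat * seq nat :=
  if l is x :: l' then
    let: (m, l1) := isort l' in let: (m', l2) := insert x l1 in ((m + m')%N, l2)
  else (0%N, [::]).

Lemma coef_swap (R : realType) (k n : nat) (w : 'M[R]_(k, n.+1) -> R) l1 a b l2 :
  is_form w -> size (l1 ++ a :: b :: l2) = k ->
  coef w (l1 ++ a :: b :: l2) = - coef w (l1 ++ b :: a :: l2).
Proof.
move=> fw; rewrite size_cat /= => sk.
have ik : (size l1 < k)%N by lia.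
have jk : ((size l1).+1 < k)%N by lia.
have ij : Ordinal ik != Ordinal jk by rewrite -val_eqE /=; lia.
rewrite /coef -(form_tperm _ fw ij); congr w.
apply/matrixP=> c d; rewrite !mxE; congr ((_ == _)%:R); rewrite /idx; congr inord.
case: tpermP => [->|->|ci cj] /=.
- by rewrite !nth_cat ltnn subnn ltnNge leqnSn /= subSnn.
- by rewrite !nth_cat ltnn subnn ltnNge leqnSn /= subSnn.
rewrite !nth_cat; case: ltnP => // lc.
have {}ci : val c <> size l1 by move=> E; apply: ci; apply: val_inj.
have {}cj : val c <> (size l1).+1 by move=> E; apply: cj; apply: val_inj.
by move: ci cj lc => /=; case E : (c - size l1)%N => [|[|m]] //; lia.
Qed.

Lemma size_insert x l : size (insert x l).2 = (size l).+1.
Proof. by elim: l => //= y l; case: ifP => //; case: insert => m l' _ /= ->. Qed.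

Lemma coef_insert (R : realType) (k n : nat) (w : 'M[R]_(k, n.+1) -> R) l x l' :
  is_form w -> size (l ++ x :: l') = k ->
  coef w (l ++ x :: l') = (-1) ^+ (insert x l').1 * coef w (l ++ (insert x l').2).
Proof.
move=> fw; elim: l' l => [|y l' IH] l sk /=; first by rewrite mul1r.
case: ifP => _ /=; first by rewrite mul1r.
rewrite coef_swap // -cat_rcons IH; last by rewrite -sk !size_cat size_rcons /=; lia.
by case: insert => m l'' /=; rewrite cat_rcons exprS mulN1r mulNr.
Qed.

(** The induction carries an arbitrary prefix that stays in place while the rest is sorted. *)
Lemma coef_isort (R : realType) (k n : nat) (w : 'M[R]_(k, n.+1) -> R) l :
  is_form w -> size l = k -> coef w l = (-1) ^+ (isort l).1 * coef w (isort l).2.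
Proof.
move=> fw; suff H l0 : size (l0 ++ l) = k ->
    coef w (l0 ++ l) = (-1) ^+ (isort l).1 * coef w (l0 ++ (isort l).2) by exact: (H [::]).
elim: l l0 => [|x l' IH] l sk /=; first by rewrite mul1r.
rewrite -cat_rcons IH ?cat_rcons //; case E : (isort l') => [m l1] /=.
have sl : size l1 = size l'.
  move: E; clear; elim: l' m l1 => [|y l' IH] m l1 /=; first by case=> _ <-.
  case: isort IH => m2 l2 /(_ _ _ erefl) <-.
  by have := size_insert y l2; case: insert => m3 l3 /= <- [_ <-].
rewrite coef_insert //; last by rewrite -sk !size_cat /= sl.
by case: insert => m' l2 /=; rewrite exprD mulrA.
Qed.

Lemma coef_nuniq (R : realType) (k n : nat) (w : 'M[R]_(k, n.+1) -> R) l :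
  is_form w -> size l = k -> ~~ uniq l -> coef w l = 0.
Proof.
move=> fw sl /(uniqPn 0%N)[i [j [ij jl lij]]]; rewrite sl in jl.
apply: form_rowsub_noninj => //; apply/injectivePn.
exists (Ordinal (ltn_trans ij jl)); exists (Ordinal jl); first by rewrite -val_eqE /=; lia.
by rewrite /idx /= lij.
Qed.

Fixpoint combs (k : nat) (l : seq nat) : seq (seq nat) :=
  if k is k'.+1 then
    if l is x :: l' then [seq x :: s | s <- combs k' l'] ++ combs k l' else [::]
  else [:: [::]].

Lemma mem_combs k l s : (s \in combs k l) = (size s == k) && subseq s l.
Proof.
elim: l k s => [|x l IH] [|k] s //=; rewrite ?inE; try by case: s.
- by rewrite andbC; case: s.
case: s => [|y s]; rewrite mem_cat IH.
  by rewrite orbF; apply/mapP=> -[].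
rewrite /= eqSS; have [-> | yx] := eqVneq y x.
  rewrite mem_map; last by move=> ? ? [].
  rewrite IH -andb_orr; congr (_ && _); apply: orb_idr.
  by apply: subseq_trans; exact: subseq_cons.
by case: mapP => // -[? _ [] /eqP]; rewrite (negbTE yx).
Qed.

Definition quads := combs 4 (iota 0 8).
Definition compl (l : seq nat) := [seq i <- iota 0 8 | i \notin l].

Lemma combs_uniq k l : uniq l -> uniq (combs k l).
Proof.
elim: l k => [|x l IH] [|k] //= /andP[xl ul].
rewrite cat_uniq map_inj_uniq ?IH //; last by move=> ? ? [].
rewrite andbT; apply/hasPn => s; rewrite mem_combs => /andP[_ /mem_subseq sl].
by apply: contra xl => /mapP[s' _ E]; apply: sl; rewrite E mem_head.
Qed.

Lemma idx_val (k n : nat) (J : k.-tuple 'I_n.+1) : @idx k n [seq val i | i <- J] =1 tnth J.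
Proof.
by move=> i; rewrite /idx (nth_map ord0) ?size_tuple // inord_val (tnth_nth ord0).
Qed.

Lemma basis_rows_idx (R : realType) (k n : nat) (J : k.-tuple 'I_n.+1) :
  basis_rows R J = rowsub (idx [seq val i | i <- J]) 1%:M.
Proof. by apply/matrixP=> i j; rewrite !mxE idx_val. Qed.

(** Increasing tuples correspond to the subsequences of [iota 0 n.+1] of size k. This turns the sums
    in [form_norm] and [hodge] into sums over an explicit list. *)
Lemma sum_combs (R : realType) (k n : nat) (F : seq nat -> R) :
  \sum_(J : k.-tuple 'I_n.+1 | increasing J) F [seq val i | i <- J] =
  \sum_(K <- combs k (iota 0 n.+1)) F K.
Proof.
rewrite -big_filter -(big_map (fun J : k.-tuple 'I_n.+1 => [seq val i | i <- J]) predT F).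
apply/perm_big/uniq_perm.
- rewrite map_inj_uniq ?filter_uniq ?index_enum_uniq //.
  by move=> J K /(inj_map val_inj) /val_inj.
- by apply: combs_uniq; exact: iota_uniq.
move=> s; rewrite mem_combs; apply/mapP/andP => [[J] | [/eqP sk ss]].
  rewrite mem_filter => /andP[iJ _] ->; rewrite size_map size_tuple; split => //.
  have -> : [seq val i | i <- J] = [seq i <- iota 0 n.+1 | i \in [seq val i | i <- J]].
    apply: (irr_sorted_eq ltn_trans ltnn iJ).
      by apply: sorted_filter; [exact: ltn_trans | exact: iota_ltn_sorted].
    move=> i; rewrite mem_filter mem_iota /= andb_idr //.
    by case/mapP=> j _ ->; exact: ltn_ord.
  exact: filter_subseq.
have sn i : i \in s -> (i < n.+1)%N by move/(mem_subseq ss); rewrite mem_iota.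
have sz : size [seq inord i : 'I_n.+1 | i <- s] == k by rewrite size_map sk.
have E : s = [seq val i | i <- Tuple sz].
  rewrite /= -map_comp -[LHS]map_id; apply/eq_in_map=> i /sn si /=.
  by rewrite inordK.
exists (Tuple sz) => //; rewrite mem_filter mem_index_enum andbT /increasing -E.
by apply: (subseq_sorted ltn_trans ss); exact: iota_ltn_sorted.
Qed.

Lemma col_mx_idx (R : realType) (k l n : nat) (J K : seq nat) : size J = k ->
  col_mx (rowsub (@idx k n J) 1%:M) (rowsub (@idx l n K) 1%:M) =
  rowsub (@idx (k + l) n (J ++ K)) 1%:M :> 'M[R]_(k + l, n.+1).
Proof.
move=> sJ; apply/matrixP=> i j; rewrite mxE; case: (split_ordP i) => a ->; rewrite !mxE /idx /=.
  by rewrite nth_cat sJ ltn_ord.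
by rewrite nth_cat sJ ltnNge leq_addr /= addKn.
Qed.

Definition det8 (R : realType) : 'M[R]_8 -> R := fun A => \det A.

(** The sign of the permutation sorting l, or 0 when an index repeats: for 4-sets J and K, the
    volume form on e_J followed by e_K. It is an integer so that it can be computed. *)
Definition signature (l : seq nat) : int :=
  if uniq l then (-1) ^+ (isort l).1 else 0.

Lemma coef_det8 (R : realType) J K : J \in quads -> K \in quads ->
  coef (@det8 R) (J ++ K) = (signature (J ++ K))%:~R.
Proof.
move=> JQ KQ.
have sJ : size J = 4 by move: JQ; rewrite mem_combs => /andP[/eqP].
have sK : size K = 4 by move: KQ; rewrite mem_combs => /andP[/eqP].
have sJK : size (J ++ K) = 8 by rewrite size_cat sJ sK.
rewrite /signature; case: ifP => [u | /negbT nu]; last first.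
  by rewrite coef_nuniq //; exact: is_form_det_id.
have chk : all (fun J => all (fun K =>
    uniq (J ++ K) ==> ((isort (J ++ K)).2 == iota 0 8)) quads) quads.
  by vm_compute.
have /eqP E : (isort (J ++ K)).2 == iota 0 8.
  by move/allP/(_ _ JQ)/allP/(_ _ KQ)/implyP: chk; apply.
rewrite coef_isort // ?E; last exact: is_form_det_id.
suff -> : coef (@det8 R) (iota 0 8) = 1 by rewrite mulr1 rmorphXn rmorphN1.
rewrite /coef /det8 -[RHS](det1 R 8); congr (\det _); apply/matrixP=> i j.
rewrite !mxE; congr ((_ == _)%:R).
by rewrite /idx nth_iota // inord_val.
Qed.

Lemma isort_quads l : size l = 4 -> all (gtn 8) l -> uniq l -> (isort l).2 \in quads.
Proof.
case: l => [|a [|b [|c [|d []]]]] // _ /= /and5P[a8 b8 c8 d8 _] ul.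
have chk : all (fun a => all (fun b => all (fun c => all (fun d =>
   uniq [:: a; b; c; d] ==> ((isort [:: a; b; c; d]).2 \in quads))
   (iota 0 8)) (iota 0 8)) (iota 0 8)) (iota 0 8) by vm_compute.
have in8 e : (e < 8)%N -> e \in iota 0 8 by rewrite mem_iota.
move: chk => /allP/(_ _ (in8 _ a8))/allP/(_ _ (in8 _ b8)).
by move=> /allP/(_ _ (in8 _ c8))/allP/(_ _ (in8 _ d8))/implyP; apply.
Qed.

Lemma form_quads_ext (R : realType) (w x : 'M[R]_(4, 8) -> R) :
  is_form w -> is_form x -> (forall K, K \in quads -> coef w K = coef x K) -> w =1 x.
Proof.
move=> fw fx wx; apply: row_linear_ext => [||f]; try exact: form_linear.
pose s := [seq val (f i) | i <- enum 'I_4].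
have sz : size s = 4 by rewrite size_map size_enum_ord.
have -> : rowsub f 1%:M = rowsub (@idx 4 7 s) 1%:M :> 'M[R]_(4, 8).
  apply/matrixP=> i j; rewrite !mxE /idx (nth_map ord0) ?size_enum_ord // nth_ord_enum.
  by rewrite inord_val.
rewrite -!/(coef _ _); have [us | ns] := boolP (uniq s); last by rewrite !coef_nuniq.
rewrite !(@coef_isort _ _ _ _ s) //; congr (_ * _); apply: wx.
apply: isort_quads => //.
by apply/allP=> _ /mapP[i _ ->]; exact: ltn_ord.
Qed.

(** In the Hodge sum evaluated at e_K only the sets J disjoint from K contribute, and among the
    4-subsets of eight indices the complement is the only one. *)
Lemma coef_compl (R : realType) (w : 'M[R]_(4, 8) -> R) K :
  self_dual w -> K \in quads ->
  coef w K = (signature (compl K ++ K))%:~R * coef w (compl K).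
Proof.
move=> sw KQ; rewrite {1}/coef -sw /hodge.
under eq_bigr => J _ do rewrite basis_rows_idx col_mx_idx ?size_map ?size_tuple //.
rewrite (sum_combs 4 7 (fun J => coef w J * coef (@det8 R) (J ++ K))).
have chk : all (fun K => (compl K \in quads) &&
    all (fun J => (J == compl K) || ~~ uniq (J ++ K)) quads) quads.
  by vm_compute.
have /andP[CQ /allP chkK] := allP chk K KQ.
have uq : uniq quads by vm_compute.
rewrite (bigD1_seq (compl K)) //= big1_seq ?addr0 => [|J /andP[JK JQ]].
  by rewrite coef_det8 // mulrC.
rewrite coef_det8 // /signature; have := chkK J JQ.
by rewrite (negbTE JK) /= => /negbTE ->; rewrite mulr0.
Qed.


Lemma quadsP K : K \in quads -> [/\ size K = 4, uniq K & all (gtn 8) K].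
Proof.
have chk : all (fun K => [&& size K == 4, uniq K & all (gtn 8) K]) quads by vm_compute.
by move/(allP chk) => /and3P[/eqP].
Qed.

Lemma idx_inj (k n : nat) l :
  size l = k -> uniq l -> all (gtn n.+1) l -> injective (@idx k n l).
Proof.
move=> sl ul /allP nl i j /(congr1 val); rewrite /idx /= !inordK; last 2 first.
- by apply: nl; rewrite mem_nth ?sl.
- by apply: nl; rewrite mem_nth ?sl.
by move/eqP; rewrite nth_uniq ?sl // => /eqP /val_inj.
Qed.

(** * Coefficients of the Cayley form *)

Lemma coef_wedge (R : realType) J K : J \in quads -> K \in quads ->
  coef (fun v : 'M[R]_(4, 8) => \det (colsub (@idx 4 7 J) v)) K = (J == K)%:R.
Proof.
move=> JQ KQ; have [sK uK nK] := quadsP KQ; have [sJ uJ nJ] := quadsP JQ.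
rewrite /coef; have [<- | JK] := eqVneq J K.
  rewrite -[RHS](det1 R 4); congr (\det _); apply/matrixP=> i j.
  by rewrite !mxE (inj_eq (idx_inj sJ uJ nJ)).
have chk : all (fun J : seq nat => all (fun K =>
    (J == K) || has [pred x | x \notin J] K) quads) quads by vm_compute.
(* An index of K outside J gives a zero row in the minor. *)
have := allP (allP chk _ JQ) _ KQ; rewrite (negbTE JK) /= => /(has_nthP 0%N)[i iK /= niJ].
rewrite sK in iK; rewrite (expand_det_row _ (Ordinal iK)) big1 // => j _.
rewrite !mxE; case: eqP => [E | _]; last by rewrite mul0r.
case/negP: niJ; move/(congr1 val): E; rewrite /idx /= !inordK; last 2 first.
- by apply: (allP nJ); rewrite mem_nth ?sJ.
- by apply: (allP nK); rewrite mem_nth ?sK.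
by move=> ->; rewrite mem_nth ?sJ.
Qed.

Lemma is_form_comb (R : realType) (k n : nat) (w x : 'M[R]_(k, n) -> R) a b :
  is_form w -> is_form x -> is_form (fun v => a * w v + b * x v).
Proof.
move=> fw fx; split=> [A B C i c d Ai BA CA | A i j ij Aij].
  by rewrite (form_linear fw Ai BA CA) (form_linear fx Ai BA CA); ring.
by rewrite (form_alternate fw ij Aij) (form_alternate fx ij Aij) !mulr0 addr0.
Qed.

Lemma is_form_ext (R : realType) (k n : nat) (w x : 'M[R]_(k, n) -> R) :
  w =1 x -> is_form x -> is_form w.
Proof. by move/funext->. Qed.

(** A basis form has a single nonzero coefficient, so the sum defining its Hodge star collapses to
    one determinant. *)
Lemma e4E (R : realType) (j k l m : nat) v :
  [:: j.-1; k.-1; l.-1; m.-1] \in quads ->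
  @e4 R j k l m v =
  \det (colsub (@idx 4 7 [:: j.-1; k.-1; l.-1; m.-1]) v) +
  \det (col_mx (rowsub (@idx 4 7 [:: j.-1; k.-1; l.-1; m.-1]) 1%:M) v : 'M_(4 + 4)).
Proof.
set J := [:: _; _; _; _] => JQ; rewrite /e4.
set t := [tuple _; _; _; _].
have tE : tnth t =1 @idx 4 7 J by case=> [[|[|[|[|]]]]] // ?; rewrite (tnth_nth ord0).
have wE u : wedge_basis t u = \det (colsub (@idx 4 7 J) u) :> R.
  by rewrite /wedge_basis; congr (\det _); apply/matrixP=> a b; rewrite !mxE tE.
rewrite wE; congr (_ + _); rewrite /hodge.
under eq_bigr => K _ do rewrite basis_rows_idx wE.
rewrite (sum_combs 4 7 (fun K => coef (fun u : 'M[R]_(4, 8) => \det (colsub (@idx 4 7 J) u)) K *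
   \det (col_mx (rowsub (@idx 4 7 K) 1%:M) v : 'M_(4 + 4)))).
have uq : uniq quads by vm_compute.
rewrite (bigD1_seq J) //= coef_wedge // eqxx mul1r big1_seq ?addr0 // => K /andP[KJ KQ].
by rewrite coef_wedge // eq_sym (negbTE KJ) mul0r.
Qed.

Lemma is_form_e4 (R : realType) (j k l m : nat) :
  [:: j.-1; k.-1; l.-1; m.-1] \in quads -> is_form (@e4 R j k l m).
Proof.
move=> JQ.
apply: (is_form_ext (x := fun v => 1 * \det (colsub (@idx 4 7 [:: j.-1; k.-1; l.-1; m.-1]) v) +
  1 * \det (col_mx (rowsub (@idx 4 7 [:: j.-1; k.-1; l.-1; m.-1]) 1%:M) v : 'M_(4 + 4)))).
  by move=> v; rewrite e4E // !mul1r.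
by apply: is_form_comb; [exact: is_form_det_colsub | exact: (@is_form_det_col_mxr R 4 4)].
Qed.

Lemma coef_e4 (R : realType) (j k l m : nat) K :
  [:: j.-1; k.-1; l.-1; m.-1] \in quads -> K \in quads ->
  coef (@e4 R j k l m) K =
  (([:: j.-1; k.-1; l.-1; m.-1] == K)%:Z + signature ([:: j.-1; k.-1; l.-1; m.-1] ++ K))%:~R.
Proof.
move=> JQ KQ; rewrite [LHS]e4E // rmorphD /=.
congr (_ + _); first exact: (coef_wedge R JQ KQ).
rewrite -[RHS](coef_det8 R JQ KQ); congr (\det _); exact: col_mx_idx.
Qed.

Definition cayley_quads := [:: [:: 0; 1; 2; 3]; [:: 0; 1; 4; 5]; [:: 0; 1; 6; 7];
  [:: 0; 2; 4; 6]; [:: 0; 2; 5; 7]; [:: 0; 3; 4; 7]; [:: 0; 3; 5; 6]]%N.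

(** In each [e J], the equality test is the contribution of e_J and the signature that of its Hodge
    dual. *)
Definition cayley_coef (K : seq nat) : int :=
  let e J := (J == K)%:Z + signature (J ++ K) in
  e [:: 0; 1; 2; 3] + e [:: 0; 1; 4; 5] + e [:: 0; 1; 6; 7] + e [:: 0; 2; 4; 6]
  - e [:: 0; 2; 5; 7] - e [:: 0; 3; 4; 7] - e [:: 0; 3; 5; 6].

Lemma coef_cayley (R : realType) K :
  K \in quads -> coef (@cayley R) K = (cayley_coef K)%:~R.
Proof.
move=> KQ; transitivity (coef (@e4 R 1 2 3 4) K + coef (@e4 R 1 2 5 6) K + coef (@e4 R 1 2 7 8) K
  + coef (@e4 R 1 3 5 7) K - coef (@e4 R 1 3 6 8) K - coef (@e4 R 1 4 5 8) K
  - coef (@e4 R 1 4 6 7) K) => //.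
by rewrite !coef_e4 // /cayley_coef !rmorphB !rmorphD.
Qed.

Lemma is_form_cayley (R : realType) : is_form (@cayley R).
Proof.
have f j k l m := @is_form_e4 R j k l m.
apply: (is_form_ext (x := fun v => 1 * (1 * (1 * (1 * (1 * (1 * e4 1 2 3 4 v
  + 1 * e4 1 2 5 6 v) + 1 * e4 1 2 7 8 v) + 1 * e4 1 3 5 7 v) + -1 * e4 1 3 6 8 v)
  + -1 * e4 1 4 5 8 v) + -1 * e4 1 4 6 7 v)).
  by move=> v; rewrite !mul1r !mulN1r.
by do 6![apply: is_form_comb; last exact: f]; exact: f.
Qed.

Definition cayley_support (R : realType) (w : 'M[R]_(4, 8) -> R) : Prop :=
  forall K, K \in quads -> K \notin cayley_quads -> compl K \notin cayley_quads ->
  coef w K = 0.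

(** Self-duality fixes the coefficients on the complements of the seven sets, and the support
    condition fixes the rest. That the Cayley form obeys the same rules is checked by
    computation. *)
Lemma cayleyP (R : realType) (w : 'M[R]_(4, 8) -> R) c :
  is_form w -> self_dual w -> cayley_support w ->
  (forall K, K \in cayley_quads -> coef w K = c * (cayley_coef K)%:~R) ->
  forall v, w v = c * cayley v.
Proof.
move=> fw sw hw H v.
have fc : is_form (fun v => c * @cayley R v).
  apply: (is_form_ext (x := fun v => c * @cayley R v + 0 * cayley v)).
    by move=> u; rewrite mul0r addr0.
  by apply: is_form_comb; exact: is_form_cayley.
apply: (form_quads_ext fw fc) => K KQ.
rewrite -[RHS]/(c * coef (@cayley R) K) coef_cayley //.
have chk : all (fun K => (K \in cayley_quads) ||
    if compl K \in cayley_quads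
    then cayley_coef K == signature (compl K ++ K) * cayley_coef (compl K)
    else cayley_coef K == 0) quads by vm_compute.
have := allP chk _ KQ; have [/H // | nK /=] := boolP (K \in cayley_quads).
case: ifP => [cK /eqP -> | /negbT nC /eqP ->]; last by rewrite hw // mulr0.
by rewrite coef_compl // H // rmorphM /= mulrCA.
Qed.

(** * The comass bound, and the effect of coordinate rotations on coefficients *)

Lemma le_comass (R : realType) (k n : nat) (w : 'M[R]_(k, n) -> R) v :
  is_form w -> (forall i, euclidean_norm (row i v) = 1) -> w v <= comass w.
Proof.
move=> fw v1; apply: ub_le_sup; last by exists v.
(* The supremum is meaningful only for a set bounded above: entries of unit rows are at most 1 in
   absolute value, so the sum of the absolute values of the coefficients is a bound. *)
exists (\sum_(f : {ffun 'I_k -> 'I_n}) `|w (rowsub f 1%:M)|) => _ [u /= u1 <-].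
rewrite row_linear_expand; last exact: form_linear.
apply: ler_sum => f _; apply: le_trans (ler_norm _) _; rewrite normrM ler_piMl //.
  rewrite normr_prod; apply: prodr_ile1 => i _; rewrite normr_ge0 /=.
  have H : \sum_(j < n) u i j ^+ 2 = 1.
    have := u1 i; rewrite /euclidean_norm => /(congr1 (fun x => x ^+ 2)).
    rewrite sqr_sqrtr ?expr1n => [<-|]; last by apply: sumr_ge0 => j _; exact: sqr_ge0.
    by apply: eq_bigr => j _; rewrite mxE.
  rewrite -(@expr_le1 _ 2) // -normrX ger0_norm ?sqr_ge0 // -H (bigD1 (f i)) //= lerDl.
  by apply: sumr_ge0 => j _; exact: sqr_ge0.
Qed.

Lemma idx_index (k n : nat) l p : size l = k -> p \in l ->
  {i : 'I_k | val i = index p l & @idx k n l i = inord p}.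
Proof.
move=> sl pl; have ik : (index p l < k)%N by rewrite -sl index_mem.
by exists (Ordinal ik) => //; rewrite /idx /= nth_index.
Qed.

Lemma idx_notin (k n : nat) l p : size l = k -> all (gtn n.+1) l -> (p < n.+1)%N ->
  p \notin l -> forall j, @idx k n l j != inord p.
Proof.
move=> sl /allP nl pn pl j; apply: contra pl => /eqP /(congr1 val).
by rewrite /idx /= !inordK // => [<-|]; last apply: nl; rewrite mem_nth ?sl.
Qed.

Lemma coef_rotation_in (R : realType) (k n : nat) (w : 'M[R]_(k, n.+1) -> R) l p q c s :
  is_form w -> size l = k -> uniq l -> all (gtn n.+1) l ->
  p \in l -> q \in l -> p != q -> c ^+ 2 + s ^+ 2 = 1 ->
  w (rowsub (idx l) (plane_rotation (inord p) (inord q) c s)) = coef w l.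
Proof.
move=> fw sl ul nl pl ql pq cs.
have [i ip <-] := idx_index n sl pl; have [j jq <-] := idx_index n sl ql.
apply: form_plane_rotation_both => //; first exact: idx_inj.
rewrite -val_eqE /= ip jq; apply: contra pq => /eqP E.
by rewrite -(nth_index 0%N pl) E nth_index.
Qed.

Lemma coef_rotation_out (R : realType) (k n : nat) (w : 'M[R]_(k, n.+1) -> R) l p q c s :
  size l = k -> all (gtn n.+1) l -> (p < n.+1)%N -> (q < n.+1)%N ->
  p \notin l -> q \notin l ->
  w (rowsub (idx l) (plane_rotation (inord p) (inord q) c s)) = coef w l.
Proof.
by move=> sl nl pn qn pl ql; apply: form_plane_rotation_none; exact: idx_notin.
Qed.

Definition subst (p q : nat) (l : seq nat) := [seq if x == p then q else x | x <- l].

Lemma coef_rotation_mixed (R : realType) (k n : nat) (w : 'M[R]_(k, n.+1) -> R) l p q c s :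
  is_form w -> size l = k -> uniq l -> all (gtn n.+1) l -> (q < n.+1)%N ->
  p \in l -> q \notin l ->
  w (rowsub (idx l) (plane_rotation (inord p) (inord q) c s)) =
  c * coef w l + s * coef w (subst p q l).
Proof.
move=> fw sl ul nl qn pl ql.
have [i ip Ei] := idx_index n sl pl.
rewrite -Ei form_plane_rotation_one //; [|exact: idx_inj|exact: idx_notin].
congr (_ + _ * w _); apply/matrixP=> a b; rewrite !mxE; congr ((_ == _)%:R).
have E : (nth 0%N l a == p) = (a == i).
  by rewrite -{1}(nth_index 0%N pl) nth_uniq ?index_mem ?sl // -ip.
by rewrite /idx (nth_map 0%N) ?sl // E; case: ifP.
Qed.

(** With r = sqrt(a^2 + b^2) nonzero, the point (a / r, b / r) gives r <= a, hence b = 0. The point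
    (-1, 0) gives the sign of a. *)
Lemma max_on_circle (R : realType) (a b : R) :
  (forall c s, c ^+ 2 + s ^+ 2 = 1 -> c * a + s * b <= a) -> b = 0 /\ 0 <= a.
Proof.
move=> H; have a0 : 0 <= a.
  have := H (-1) 0; rewrite sqrrN expr1n expr0n addr0 mulN1r mul0r addr0 => /(_ erefl); lra.
split=> //; apply/eqP; rewrite -sqrf_eq0.
have r0 : 0 <= a ^+ 2 + b ^+ 2 by rewrite addr_ge0 ?sqr_ge0.
have [/eqP|rn] := eqVneq (a ^+ 2 + b ^+ 2) 0.
  by rewrite paddr_eq0 ?sqr_ge0 // => /andP[].
pose r := Num.sqrt (a ^+ 2 + b ^+ 2).
have rr : r ^+ 2 = a ^+ 2 + b ^+ 2 by rewrite sqr_sqrtr.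
have rp : 0 < r by rewrite sqrtr_gt0 lt_neqAle eq_sym rn.
have := H (a / r) (b / r); rewrite !expr_div_n -mulrDl rr divff // => /(_ erefl).
have -> : a / r * a + b / r * b = (a ^+ 2 + b ^+ 2) / r by rewrite !expr2; ring.
rewrite -rr expr2 mulfK => [ra|]; last by rewrite gt_eqF.
have : r ^+ 2 <= a ^+ 2 by rewrite ler_sqr ?nnegrE // ltW.
by rewrite rr gerDl => b0; rewrite eq_le b0 sqr_ge0.
Qed.

(** * Test vectors (e_a +- e_b) / sqrt 2 and the inequalities they give *)

(* The expansion of the wedge of the vectors e_a + (-1)^t e_b, for (a, b, t) in
   the list, as signed words. *)
Fixpoint plane_terms (ts : seq (nat * nat * bool)) : seq (bool * seq nat) :=
  if ts is (a, b, t) :: ts' then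
    [seq (x.1, a :: x.2) | x <- plane_terms ts'] ++
    [seq (x.1 (+) t, b :: x.2) | x <- plane_terms ts']
  else [:: (false, [::])].

Definition basis_row (R : realType) (n a : nat) : 'rV[R]_n.+1 := delta_mx 0 (inord a).

Definition plane_row (R : realType) (n : nat) (t : nat * nat * bool) : 'rV[R]_n.+1 :=
  let r := Num.sqrt 2^-1 in
  r *: basis_row R n t.1.1 + (r * (-1) ^+ t.2) *: basis_row R n t.1.2.

Definition rows_of (R : realType) (k n : nat) (us : seq 'rV[R]_n) : 'M[R]_(k, n) :=
  \matrix_(i < k) nth 0 us i.

Lemma rows_of_upd (R : realType) (k n : nat) (us vs : seq 'rV[R]_n) u u' (i : 'I_k) :
  val i = size us ->
  upd i u (rows_of k (us ++ u' :: vs)) = rows_of k (us ++ u :: vs).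
Proof.
move=> iu; apply/matrixP=> a b; rewrite !mxE !nth_cat -val_eqE /= iu.
case: ltngtP => [//|lt|->]; last by rewrite subnn.
by case E : (a - size us)%N => [|m] //; lia.
Qed.

Lemma plane_expand (R : realType) (k n : nat) (w : 'M[R]_(k, n.+1) -> R) ts :
  is_form w -> size ts = k ->
  w (rows_of k (map (@plane_row R n) ts)) =
  Num.sqrt 2^-1 ^+ k * \sum_(x <- plane_terms ts) (-1) ^+ x.1 * coef w x.2.
Proof.
move=> fw sk.
(* Generalized to a prefix of rows already replaced by basis vectors, recorded in l. *)
suff H l : size (map (basis_row R n) l ++ map (@plane_row R n) ts) = k ->
  w (rows_of k (map (basis_row R n) l ++ map (@plane_row R n) ts)) =
  Num.sqrt 2^-1 ^+ size ts * \sum_(x <- plane_terms ts) (-1) ^+ x.1 * coef w (l ++ x.2).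
  by have := H [::]; rewrite /= size_map sk => /(_ erefl).
elim: ts l {sk} => [|[[a b] t] ts IH] l /= sk.
  rewrite cats0 expr0 mul1r big_seq1 mul1r cats0 /coef; congr w.
  move: sk; rewrite cats0 size_map => sk.
  by apply/matrixP=> i j; rewrite !mxE (nth_map 0%N) ?sk // mxE eqxx /= eq_sym.
have ik : (size (map (basis_row R n) l) < k)%N by rewrite -sk size_cat /=; lia.
rewrite -(rows_of_upd _ _ 0 (i := Ordinal ik)) //.
rewrite linear_upd; last exact: form_linear.
rewrite !rows_of_upd // -!cat_rcons -!map_rcons !IH; last 2 first.
- by rewrite -sk !size_cat /= !size_map size_rcons; lia.
- by rewrite -sk !size_cat /= !size_map size_rcons; lia.
rewrite big_cat !big_map /= exprS.
under eq_bigr => x _ do rewrite cat_rcons.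
under [X in _ + _ * (_ * X)]eq_bigr => x _ do rewrite cat_rcons.
under [X in _ = _ * (_ + X)]eq_bigr => x _ do rewrite signr_addb [_ * (-1) ^+ t]mulrC -mulrA.
by rewrite -mulr_sumr; ring.
Qed.

Lemma plane_row_unit (R : realType) (n : nat) a b t : (a < n.+1)%N -> (b < n.+1)%N -> a != b ->
  euclidean_norm (@plane_row R n (a, b, t)) = 1.
Proof.
move=> an bn ab; rewrite /euclidean_norm -[RHS]sqrtr1; congr Num.sqrt.
have ab' : (inord a : 'I_n.+1) != inord b.
  by apply: contra ab => /eqP /(congr1 val); rewrite /= !inordK // => ->.
rewrite (bigD1 (inord a)) // (bigD1 (inord b)) /=; last by rewrite eq_sym.
rewrite big1 ?addr0 => [|i /andP[ia ib]]; last first.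
  by rewrite !mxE !eqxx (negbTE ia) (negbTE ib) !mulr0 addr0 expr0n.
rewrite !mxE !eqxx (negbTE ab') [inord b == _]eq_sym (negbTE ab') /=.
rewrite !mulr1 !mulr0 addr0 add0r exprMn sqrr_sign mulr1 sqr_sqrtr; first by field.
by rewrite invr_ge0.
Qed.

(** The four factors 1 / sqrt 2 multiply to 1/4, which is the origin of the 4 on the right. *)
Lemma plane_bound (R : realType) (w : 'M[R]_(4, 8) -> R) M ts :
  is_form w -> (forall v, (forall i, euclidean_norm (row i v) = 1) -> w v <= M) ->
  size ts = 4 -> all (fun t => [&& t.1.1 < 8, t.1.2 < 8 & t.1.1 != t.1.2]%N) ts ->
  \sum_(x <- plane_terms ts) (-1) ^+ x.1 * coef w x.2 <= 4 * M.
Proof.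
move=> fw wM st ut.
have := wM (rows_of 4 (map (@plane_row R 7) ts)); rewrite plane_expand //.
set S := \sum_(_ <- _) _.
have -> : Num.sqrt 2^-1 ^+ 4 = 4^-1 :> R.
  by rewrite (exprM _ 2 2) sqr_sqrtr ?invr_ge0 // expr2; field.
move=> H; suff : 4^-1 * S <= M by lra.
apply: H => i.
have -> : row i (rows_of 4 (map (@plane_row R 7) ts)) = plane_row R 7 (nth (0, 0, false)%N ts i).
  by apply/rowP=> j; rewrite [LHS]mxE [LHS]mxE (nth_map (0, 0, false)%N) ?st.
have /(all_nthP (0, 0, false)%N)/(_ i) := ut; rewrite st => /(_ (ltn_ord i)).
by case: nth => [[a b] t] /and3P[/=]; exact: plane_row_unit.
Qed.

Lemma plane_rotation_flipC (R : realType) (n : nat) (p q : 'I_n) : p != q ->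
  plane_rotation p q (-1) 0 = plane_rotation q p (-1) 0 :> 'M[R]_n.
Proof.
by move=> pq; rewrite /plane_rotation oppr0 !scale0r !addr0 !add0r updC.
Qed.

Lemma coef_flip (R : realType) (k n : nat) (w : 'M[R]_(k, n.+1) -> R) l p q :
  is_form w -> size l = k -> uniq l -> all (gtn n.+1) l ->
  (p < n.+1)%N -> (q < n.+1)%N -> p != q ->
  coef (fun v => w (v *m plane_rotation (inord p) (inord q) (-1) 0)) l =
  (-1) ^+ ((p \in l) (+) (q \in l)) * coef w l.
Proof.
move=> fw sl ul nl pn qn pq.
rewrite [LHS]/coef mul_rowsub_mx mul1mx.
have [pl | pl] := boolP (p \in l); have [ql | ql] := boolP (q \in l).
- by rewrite coef_rotation_in // ?mul1r // sqrrN expr1n expr0n addr0.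
- by rewrite coef_rotation_mixed // mul0r addr0.
- rewrite plane_rotation_flipC; first by rewrite coef_rotation_mixed // mul0r addr0.
  by apply: contra pq => /eqP /(congr1 val); rewrite /= !inordK // => ->.
by rewrite coef_rotation_out // mul1r.
Qed.

(** * Vanishing of coefficients at a lexicographic maximum *)

(* e1234, e1256 and e1357, with indices numbered from 0. *)
Definition leading (i : nat) : seq nat :=
  nth [::] [:: [:: 0; 1; 2; 3]; [:: 0; 1; 4; 5]; [:: 0; 2; 4; 6]]%N i.

(* The rotations in the plane (p, q) move [leading i] but fix the coefficients
   on the previous leading sets, so maximality applies to them. *)
Definition mixing_plane (i p q : nat) : bool :=
  [&& p \in leading i, q \notin leading i &
      all (fun j => (p \in leading j) == (q \in leading j)) (iota 0 i)].

Lemma leadingP i : (i < 3)%N ->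
  [/\ size (leading i) = 4, uniq (leading i) & all (gtn 8) (leading i)].
Proof. by case: i => [|[|[|]]]. Qed.

(** Here the standard frame itself is the maximum; the condition is applied to the given form pulled
    back by a maximizing g. *)
Definition lex_max (R : realType) (w : 'M[R]_(4, 8) -> R) : Prop :=
  forall i h, (i < 3)%N -> special_orthogonal h ->
    (forall j, (j < i)%N -> w (rowsub (idx (leading j)) h) = coef w (leading j)) ->
    w (rowsub (idx (leading i)) h) <= coef w (leading i).

Lemma lex_max_critical (R : realType) (w : 'M[R]_(4, 8) -> R) i p q :
  is_form w -> lex_max w -> (i < 3)%N -> (p < 8)%N -> (q < 8)%N -> mixing_plane i p q ->
  coef w (subst p q (leading i)) = 0 /\ 0 <= coef w (leading i).
Proof.
move=> fw mw i3 p8 q8 /and3P[pl ql /allP st].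
have pq : p != q by apply: contra ql => /eqP <-.
apply: max_on_circle => c s cs.
have [sl ul nl] := leadingP i3.
rewrite -coef_rotation_mixed //; apply: mw => // [|j ji].
  apply: plane_rotation_so => //.
  by apply: contra pq => /eqP /(congr1 val); rewrite /= !inordK // => ->.
have [slj ulj nlj] := leadingP (ltn_trans ji i3).
have /eqP pqj : (p \in leading j) == (q \in leading j) by apply: st; rewrite mem_iota.
have [pj | pj] := boolP (p \in leading j).
  by apply: coef_rotation_in => //; rewrite -pqj.
by apply: coef_rotation_out => //; rewrite -pqj.
Qed.

Lemma has_iota (a : pred nat) n : has a (iota 0 n) -> exists2 i, (i < n)%N & a i.
Proof. by case/hasP=> i; rewrite mem_iota; exists i. Qed.

(** A coefficient on K vanishes because of the first leading set that K meets in an odd number of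
    indices: K or its complement arises from that set by exchanging one index along a mixing plane.
    The three stages remove 32, 16 and 8 sets, which leaves 70 - 56 = 14. *)
Lemma lex_max_support (R : realType) (w : 'M[R]_(4, 8) -> R) :
  is_form w -> self_dual w -> lex_max w -> cayley_support w.
Proof.
move=> fw sw mw K KQ /negbTE nK /negbTE nC.
have chk : all (fun K => [|| K \in cayley_quads, compl K \in cayley_quads |
    has (fun i => has (fun p => has (fun q => mixing_plane i p q &&
      [&& size (subst p q (leading i)) == 4 &
      ((isort (subst p q (leading i))).2 \in [:: K; compl K])])
      (iota 0 8)) (iota 0 8)) (iota 0 3)]) quads by vm_compute.
have := allP chk _ KQ; rewrite nK nC !orFb.
case/has_iota=> i i3 /has_iota[p p8] /has_iota[q q8] /and3P[mp /eqP ss].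
have [+ _] := lex_max_critical fw mw i3 p8 q8 mp.
rewrite coef_isort // => /eqP; rewrite mulf_eq0 signr_eq0 /= => /eqP E.
rewrite !inE => /orP[] /eqP EK; first by rewrite -EK.
by rewrite coef_compl // -EK E mulr0.
Qed.

Lemma lex_max_ge0 (R : realType) (w : 'M[R]_(4, 8) -> R) i :
  is_form w -> lex_max w -> (i < 3)%N -> 0 <= coef w (leading i).
Proof.
move=> fw mw i3.
have chk : all (fun i => has (fun p => has (mixing_plane i p) (iota 0 8)) (iota 0 8)) (iota 0 3).
  by vm_compute.
have /allP/(_ i) := chk; rewrite mem_iota => /(_ i3)/has_iota[p p8] /has_iota[q q8].
by case/(lex_max_critical fw mw i3 p8 q8).
Qed.

(** * Absolute values and signs of the surviving coefficients *)

Lemma coef_abs_eq (R : realType) (w : 'M[R]_(4, 8) -> R) M :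
  self_dual w -> cayley_support w ->
  (forall K, K \in quads -> `|coef w K| <= M) ->
  \sum_(K <- quads) coef w K ^+ 2 = 14 * M ^+ 2 ->
  forall K, K \in cayley_quads -> coef w K = M \/ coef w K = - M.
Proof.
move=> sw hw wM sumw K KC.
pose P K := (K \in quads) && ((K \in cayley_quads) || (compl K \in cayley_quads)).
have KQ : K \in quads.
  have chk : all (fun K => K \in quads) cayley_quads by vm_compute.
  exact: allP chk _ KC.
have M0 : 0 <= M by exact: le_trans (normr_ge0 _) (wM _ KQ).
have : \sum_(K <- quads | P K) (M ^+ 2 - coef w K ^+ 2) == 0.
  rewrite sumrB big_const_seq iter_addr_0.
  have -> : count P quads = 14 by vm_compute.
  rewrite [X in _ - X](_ : _ = \sum_(K <- quads) coef w K ^+ 2).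
    by rewrite sumw mulr_natl subrr.
  rewrite [LHS]big_mkcond; apply: eq_big_seq => L LQ; rewrite /P LQ /=.
  case: ifP => // /negbT; rewrite negb_or => /andP[nL nC].
  by rewrite hw // expr0n.
rewrite psumr_eq0 => [/allP/(_ _ KQ)|L /andP[LQ _]]; last first.
  rewrite subr_ge0 -[coef w L ^+ 2]ger0_norm ?sqr_ge0 // normrX.
  by rewrite ler_sqr ?nnegrE ?wM.
rewrite /P KQ KC /= subr_eq0 eq_sym eqf_sqr => /orP[] /eqP ->; by [left | right].
Qed.

(* [Some (b, K)] means (-1)^b times the coefficient on K, and [None] means 0. *)
Definition normal_term (l : seq nat) : option (bool * seq nat) :=
  let K := (isort l).2 in let b := odd (isort l).1 in
  if ~~ uniq l then None
  else if K \in cayley_quads then Some (b, K)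
  else if compl K \in cayley_quads then
    Some (b (+) odd (isort (compl K ++ K)).1, compl K)
  else None.

Lemma coef_normal_term (R : realType) (w : 'M[R]_(4, 8) -> R) l :
  is_form w -> self_dual w -> cayley_support w -> size l = 4 -> all (gtn 8) l ->
  coef w l = if normal_term l is Some x then (-1) ^+ x.1 * coef w x.2 else 0.
Proof.
move=> fw sw hw sl nl; rewrite /normal_term.
case: ifPn => [ul | /negPn ul]; first by rewrite coef_nuniq.
have KQ := isort_quads sl nl ul.
rewrite coef_isort // -signr_odd; case: ifPn => // nK.
case: ifPn => nC; last by rewrite hw // mulr0.
have chk : all (fun K => uniq (compl K ++ K)) quads by vm_compute.
rewrite coef_compl // /signature (allP chk _ KQ) rmorphXn rmorphN1 /=.
by rewrite signr_addb -[in (-1) ^+ (isort _).1]signr_odd mulrA.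
Qed.

Definition plane_normal_terms ts : seq (bool * seq nat) :=
  pmap (fun y => omap (fun z => (y.1 (+) z.1, z.2)) (normal_term y.2)) (plane_terms ts).

Lemma plane_normal_bound (R : realType) (w : 'M[R]_(4, 8) -> R) M ts :
  is_form w -> self_dual w -> cayley_support w ->
  (forall v, (forall i, euclidean_norm (row i v) = 1) -> w v <= M) ->
  size ts = 4 -> all (fun t => [&& t.1.1 < 8, t.1.2 < 8 & t.1.1 != t.1.2]%N) ts ->
  \sum_(x <- plane_normal_terms ts) (-1) ^+ x.1 * coef w x.2 <= 4 * M.
Proof.
move=> fw sw hw wM st ut; have := plane_bound fw wM st ut.
congr (_ <= _).
have : all (fun x => (size x.2 == size ts) && all (gtn 8) x.2) (plane_terms ts).
  elim: ts ut {st} => [|[[a b] t] ts IH] //= /andP[/and3P[a8 b8 _] /IH /allP H].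
  rewrite all_cat !all_map; apply/andP; split; apply/allP=> x /H /= /andP[/eqP -> ->].
    by rewrite eqxx a8.
  by rewrite eqxx b8.
rewrite st /plane_normal_terms; elim: plane_terms => [|[b l] r IH] /=; first by rewrite !big_nil.
case/andP=> /andP[/eqP sl nl] /IH {}IH; rewrite big_cons IH (coef_normal_term fw sw hw sl nl).
case: normal_term => [[b' K]|] /=; last by rewrite mulr0 add0r.
by rewrite big_cons /= signr_addb mulrA.
Qed.

(** The pairings are {i, i xor v} with v = 7, 4, 1 in binary. Of the fourteen affine planes, exactly
    eight contain one index of each pair, in four complementary couples; this is why four of the
    seven coefficients enter each inequality. For v = 7 these are the three maximized ones and the
    one on 0356. For v = 4 and v = 1 two choices of signs give opposite inequalities, hence an
    equation. *)
Lemma cayley_signs (R : realType) (w : 'M[R]_(4, 8) -> R) M :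
  is_form w -> self_dual w -> cayley_support w -> 0 < M ->
  (forall v, (forall i, euclidean_norm (row i v) = 1) -> w v <= M) ->
  (forall K, K \in cayley_quads -> coef w K = M \/ coef w K = - M) ->
  (forall i, (i < 3)%N -> 0 <= coef w (leading i)) ->
  let a := coef w [:: 0; 1; 6; 7]%N in
  [/\ coef w [:: 0; 1; 2; 3]%N = M, coef w [:: 0; 1; 4; 5]%N = M,
      coef w [:: 0; 2; 4; 6]%N = M, a = M \/ a = - M &
  [/\ coef w [:: 0; 2; 5; 7]%N = - a, coef w [:: 0; 3; 4; 7]%N = - a &
      coef w [:: 0; 3; 5; 6]%N = - M]].
Proof.
move=> fw sw hw M0 wM wpm w0 /=.
have E ts L : size ts = 4 -> all (fun t => [&& t.1.1 < 8, t.1.2 < 8 & t.1.1 != t.1.2]%N) ts ->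
    plane_normal_terms ts = L -> \sum_(x <- L) (-1) ^+ x.1 * coef w x.2 <= 4 * M.
  by move=> st ut <-; exact: plane_normal_bound.
have /= c0 := w0 0%N erefl; have /= c1 := w0 1%N erefl; have /= c2 := w0 2%N erefl.
have H0 := wpm [:: 0; 1; 2; 3]%N erefl; have H1 := wpm [:: 0; 1; 4; 5]%N erefl.
have H2 := wpm [:: 0; 2; 4; 6]%N erefl; have H3 := wpm [:: 0; 1; 6; 7]%N erefl.
have H4 := wpm [:: 0; 2; 5; 7]%N erefl; have H5 := wpm [:: 0; 3; 4; 7]%N erefl.
have H6 := wpm [:: 0; 3; 5; 6]%N erefl.
(* With x_K the coefficient on K, P1 gives x_0356 <= - M, P2 and P3 give
   x_0167 + x_0257 = 0, P4 and P5 give x_0257 = x_0347. *)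
have P1 := E [:: (0, 7, false); (1, 6, true); (2, 5, false); (3, 4, true)]%N _
  erefl erefl ltac:(vm_compute; reflexivity).
have P2 := E [:: (0, 4, false); (1, 5, false); (2, 6, true); (3, 7, true)]%N _
  erefl erefl ltac:(vm_compute; reflexivity).
have P3 := E [:: (0, 4, false); (1, 5, true); (2, 6, false); (3, 7, true)]%N _
  erefl erefl ltac:(vm_compute; reflexivity).
have P4 := E [:: (0, 1, false); (2, 3, false); (4, 5, true); (6, 7, true)]%N _
  erefl erefl ltac:(vm_compute; reflexivity).
have P5 := E [:: (0, 1, false); (2, 3, true); (4, 5, false); (6, 7, true)]%N _
  erefl erefl ltac:(vm_compute; reflexivity).
rewrite !big_cons !big_nil /= !(expr0, expr1) in P1 P2 P3 P4 P5.
move: c0 c1 c2 H0 H1 H2 H3 H4 H5 H6 P1 P2 P3 P4 P5; rewrite /leading /=.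
move: (coef w [:: 0; 1; 2; 3]%N) (coef w [:: 0; 1; 4; 5]%N) (coef w [:: 0; 2; 4; 6]%N)
  (coef w [:: 0; 1; 6; 7]%N) (coef w [:: 0; 2; 5; 7]%N) (coef w [:: 0; 3; 4; 7]%N)
  (coef w [:: 0; 3; 5; 6]%N) => x0 x1 x2 x3 x4 x5 x6 c0 c1 c2 H0 H1 H2 H3 H4 H5 H6.
have {H0}-> : x0 = M by lra.
have {H1}-> : x1 = M by lra.
have {H2}-> : x2 = M by lra.
by move=> P1 P2 P3 P4 P5; split => //; split; lra.
Qed.

(** * Orthogonal changes of frame and the identification with the Cayley form *)

Lemma euclidean_norm_orthogonal (R : realType) (n : nat) (g : 'M[R]_n) (u : 'rV[R]_n) :
  g *m g^T = 1%:M -> euclidean_norm (u *m g) = euclidean_norm u.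
Proof.
move=> gg; rewrite /euclidean_norm; congr Num.sqrt.
have E (v : 'rV[R]_n) : \sum_j v 0 j ^+ 2 = (v *m v^T) 0 0.
  by rewrite mxE; apply: eq_bigr => j _; rewrite mxE expr2.
by rewrite !E trmx_mul mulmxA -[u *m g *m _]mulmxA gg mulmx1.
Qed.

Lemma form_act_orthogonal (R : realType) (k n : nat) (g : 'M[R]_n) (w : 'M[R]_(k, n) -> R) v :
  special_orthogonal g -> form_act g w v = w (v *m g).
Proof.
move=> [gg dg]; rewrite /form_act.
have gu : g \in unitmx by rewrite unitmxE dg unitr1.
by rewrite -[invmx g]mulmx1 -gg mulKmx // trmxK.
Qed.

Lemma special_orthogonal_comass_bound (R : realType) (k n : nat) (w : 'M[R]_(k, n) -> R)
    (g : 'M[R]_n) v :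
  is_form w -> special_orthogonal g ->
  (forall i, euclidean_norm (row i v) = 1) -> w (v *m g) <= comass w.
Proof.
move=> fw [gg _] v1; apply: le_comass => // i.
by rewrite row_mul euclidean_norm_orthogonal.
Qed.

(** The hypothesis bounds w only from above; negating the first row, which keeps it a unit vector,
    gives the bound from below. *)
Lemma norm_coef_le (R : realType) (w : 'M[R]_(4, 8) -> R) M K :
  is_form w -> (forall v, (forall i, euclidean_norm (row i v) = 1) -> w v <= M) ->
  `|coef w K| <= M.
Proof.
move=> fw wM.
pose A : 'M[R]_(4, 8) := rowsub (idx K) 1%:M.
have nN (n : nat) (u : 'rV[R]_n) : euclidean_norm (- u) = euclidean_norm u.
  by congr Num.sqrt; apply: eq_bigr => j _; rewrite mxE sqrrN.
have A1 i : euclidean_norm (row i A) = 1.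
  rewrite /euclidean_norm -[RHS]sqrtr1; congr Num.sqrt.
  rewrite (bigD1 (idx K i)) //= !mxE eqxx expr1n big1 ?addr0 // => j ji.
  by rewrite !mxE eq_sym (negbTE ji) expr0n.
rewrite ler_norml wM // andbT lerNl.
have <- : w (upd ord0 (-1 *: row ord0 A) A) = - coef w K.
  by rewrite linear_updZ ?upd_row ?mulN1r //; exact: form_linear.
apply: wM => i; have [-> | i0] := eqVneq i ord0; first by rewrite row_upd scaleN1r nN.
rewrite -(A1 i); congr euclidean_norm.
by apply/rowP=> j; rewrite !mxE (negbTE i0).
Qed.

Lemma sum_quads_norm (R : realType) (w : 'M[R]_(4, 8) -> R) (g : 'M[R]_8) :
  is_form w -> g *m g^T = 1%:M ->
  \sum_(K <- quads) coef (fun v => w (v *m g)) K ^+ 2 = form_norm w ^+ 2.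
Proof.
move=> fw gg; rewrite /form_norm sqr_sqrtr; last by apply: sumr_ge0 => J _; exact: sqr_ge0.
rewrite -(sum_combs 4 7 (fun K => coef (fun v => w (v *m g)) K ^+ 2)).
under [RHS]eq_bigr => J _ do rewrite expr2.
rewrite -(form_inner_orthogonal fw fw gg); apply: eq_bigr => J _.
by rewrite /coef -basis_rows_idx /basis_rows mul_rowsub_mx mul1mx expr2.
Qed.

Lemma cayley_of_coefs (R : realType) (w : 'M[R]_(4, 8) -> R) c :
  is_form w -> self_dual w -> cayley_support w ->
  [seq coef w K | K <- cayley_quads] = [:: c; c; c; c; - c; - c; - c] ->
  forall v, w v = c * cayley v.
Proof.
move=> fw sw hw [e0 e1 e2 e3 e4 e5 e6]; apply: cayleyP => // K.
have c1 L : cayley_coef L = 1 -> c = c * (cayley_coef L)%:~R by move->; rewrite mulr1.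
have cN1 L : cayley_coef L = -1 -> - c = c * (cayley_coef L)%:~R.
  by move->; rewrite rmorphN1 mulrN1.
rewrite !inE => /or4P[|||/or4P[]] /eqP ->; rewrite ?(e0, e1, e2, e3, e4, e5, e6).
all: by [apply: c1; vm_compute | apply: cN1; vm_compute].
Qed.

Theorem theorem1p2 (R : realType) (w : 'M[R]_(4, 8) -> R)
    (hw : is_form w) (hsd : self_dual w)
    (hratio : form_norm w ^+ 2 / comass w ^+ 2 = 14) :
  exists c : R, c != 0 /\
  exists g : 'M[R]_8, special_orthogonal g /\
  forall v : 'M[R]_(4, 8), form_act g w v = c * cayley v.
Proof.
set M := comass w in hratio.
have [g og maxg] := form_lex_max_frame (fun i => @idx 4 7 (leading i)) 3 hw.
pose x v := w (v *m g).
have fx : is_form x by exact: is_form_mulmxr.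
have sx : self_dual x by exact: self_dual_mulmxr.
have gE l : w (rowsub (@idx 4 7 l) g) = coef x l.
  by rewrite /coef /x mul_rowsub_mx mul1mx.
have mx : lex_max x.
  move=> i h i3 oh hj; rewrite -gE; apply: maxg => // j ji; rewrite gE; exact: hj.
have hx := lex_max_support fx sx mx.
have xM v : (forall i, euclidean_norm (row i v) = 1) -> x v <= M.
  exact: special_orthogonal_comass_bound.
(* Division by zero yields 0, so the ratio 14 excludes a vanishing comass. *)
have M0 : M != 0.
  apply/eqP=> M0; move: hratio; rewrite M0 expr0n invr0 mulr0 => /eqP.
  by rewrite eq_sym pnatr_eq0.
(* Only the nonnegativity of M is drawn from the coefficient bound, so the list [[::]] serves as
   well as any other. *)
have Mp : 0 < M by rewrite lt_neqAle eq_sym M0 (le_trans (normr_ge0 _) (norm_coef_le [::] fx xM)).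
have sumx : \sum_(K <- quads) coef x K ^+ 2 = 14 * M ^+ 2.
  by rewrite sum_quads_norm //; [rewrite -hratio divfK // expf_neq0 | case: og].
have xpm := coef_abs_eq sx hx (fun K _ => norm_coef_le K fx xM) sumx.
have [x0 x1 x3 x2 [x4 x5 x6]] := cayley_signs fx sx hx Mp xM xpm (fun i => lex_max_ge0 fx mx).
case: x2 => x2.
  exists M; split => //; exists g; split => // v.
  rewrite form_act_orthogonal //; apply: (cayley_of_coefs fx sx hx).
  by rewrite /= x0 x1 x2 x3 x4 x5 x6 x2.
(* A half-turn in a coordinate plane changes the signs of its two basis vectors. *)
pose h p q : 'M[R]_8 := plane_rotation (inord p) (inord q) (-1) 0.
have oh p q : (p < 8)%N -> (q < 8)%N -> p != q -> special_orthogonal (h p q).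
  move=> p8 q8 pq; apply: plane_rotation_so; last by rewrite sqrrN expr1n expr0n addr0.
  by apply: contra pq => /eqP /(congr1 val); rewrite /= !inordK // => ->.
(* In the order of [cayley_quads] the coefficients are now M, M, -M, M, M, M, -M. Changing the signs
   of the basis vectors 0, 1, 2, 4 negates those on 0123, 0145, 0246 and 0356, the sets meeting {0,
   1, 2, 4} in an odd number of indices, and leaves -M times the Cayley pattern. *)
pose y v := x (v *m h 2 4); pose z v := y (v *m h 0 1).
have fy : is_form y by exact: is_form_mulmxr.
have fz : is_form z by exact: is_form_mulmxr.
have sy : self_dual y by apply: self_dual_mulmxr => //; exact: oh.
have sz : self_dual z by apply: self_dual_mulmxr => //; exact: oh.
have zE K : K \in quads ->
    coef z K = (-1) ^+ ((0 \in K) (+) (1 \in K))%N * ((-1) ^+ ((2 \in K) (+) (4 \in K))%N * coef x K).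
  by case/quadsP=> sK uK nK; rewrite !coef_flip.
have hz : cayley_support z by move=> K KQ nK nC; rewrite zE // hx // !mulr0.
exists (- M); split; first by rewrite oppr_eq0.
have og' : special_orthogonal (h 0%N 1%N *m h 2%N 4%N *m g).
  by do 2!apply: special_orthogonalM => //; exact: oh.
exists (h 0%N 1%N *m h 2%N 4%N *m g); split => // v.
rewrite form_act_orthogonal // !mulmxA -/(x _) -/(y _) -/(z _).
apply: (cayley_of_coefs fz sz hz).
by rewrite /= !zE // x0 x1 x2 x3 x4 x5 x6 x2 /= !expr1 !expr0 !mulN1r !mul1r !opprK.
Qed.
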